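(* In the setting described in the context (under the Regularity Assumption (A.1)-(A.3) and the Approximation Assumption), let $\varepsilon>0$ be sufficiently small and let $(\mathbf{y}^k,\mathbf{p}^k,\theta_k)\in W_T^{2N}\times\mathcal{R}_\varepsilon$, with $\mathbf{y}^k=(y_1^k,\dots,y_N^k)$, $\mathbf{p}^k=(p_1^k,\dots,p_N^k)$, denote an infimizing sequence for $(\mathcal{P}^N_\varepsilon)$. If $\max_i\|y_i^k\|_{L^\infty(I;\mathbb{R}^n)}\le M_\infty$ for some $M_\infty>0$ independent of $k\in\mathbb{N}$, then $(\mathcal{P}^N_\varepsilon)$ admits at least one minimizer $(\mathbf{y}^*,\mathbf{p}^*,\theta^* )$.
   Context: Setting. Let $n,m\in\mathbb{N}$, $T>0$, $I=(0,T)$, $\bar I=[0,T]$; $W_T=\{y\in L^2(I;\mathbb{R}^n):\dot y\in L^2(I;\mathbb{R}^n)\}$ with $\|y\|_{W_T}^2=\|\dot y\|_{L^2}^2+\|y\|_{L^2}^2$, and $\imath:W_T\to\mathcal{C}(\bar I;\mathbb{R}^n)$ is the continuous embedding. Let $f:\bar I\times\mathbb{R}^n\to\mathbb{R}^n$, $g:\bar I\times\mathbb{R}^n\to\mathbb{R}^{n\times m}$, with Nemytskii operators $\mathbf{f}(y)(t)=f(t,y(t))$, $(\mathbf{g}(y)u)(t)=g(t,y(t))u(t)$. Let $Q_1,Q_2\in\mathbb{R}^{n\times n}$ be symmetric positive semi-definite, $\beta>0$, $y_d\in L^2(I;\mathbb{R}^n)$, and $y_d^T\in\mathbb{R}^n$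 a desired terminal state; $\mathbf{Q}_1$ denotes pointwise multiplication by $Q_1$. For $t\in\bar I$ put $$J_t(y,u)=\tfrac12\int_t^T\big(|Q_1(y(s)-y_d(s))|^2+\beta|u(s)|^2\big)\,ds+\tfrac12|Q_2(y(T)-y_d^T)|^2,\qquad J=J_0.$$ For $y_0\in\mathbb{R}^n$, problem $(P_{y_0})$ is: minimize $J(y,u)$ over $(y,u)\in W_T\times L^2(I;\mathbb{R}^m)$ subject to $\dot y=\mathbf{f}(y)+\mathbf{g}(y)u$, $y(0)=y_0$. The value function is $V^*(t_0,y_0)=\inf J_{t_0}(y,u)$ over $y\in H^1(t_0,T;\mathbb{R}^n)$, $u\in L^2(t_0,T;\mathbb{R}^m)$ with $\dot y=f(\cdot,y)+g(\cdot,y)u$, $y(t_0)=y_0$. $\partial_y,\partial_{yy}$ denote gradient and Hessian in $y$. $Y_0\subset\mathbb{R}^n$ is compact. Regularity Assumption. (A.1) $f,g$ are twice continuously differentiable, and their Jacobians and Hessians with respect to $y$ are Lipschitz continuous on compact sets, uniformly in $t$. (A.2) There is $M_{Y_0}>0$ such that, with $\widehat M=M_{Y_0}\|\imath\|$, $V^*$ is twice continuously differentiable on $\bar I\times\bar B_{2\widehat M}(0)$ with gradient and Hessian Lipschitz continuous (w.r.t. $y$, uniformly in $t$). Let $\mathcal{F}^*(y)(t)=-\frac1\beta g(t,y(t))^\top\partial_yV^*(t,y(t))$ for $y\in W_T$ with $\|y\|_{W_T}\le2M_{Y_0}$. (A.3) For every $y_0\in Y_0$ there is a unique $y=\mathbf{y}^*(y_0)\in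 W_T$ with $\dot y=\mathbf{f}(y)+\mathbf{g}(y)\mathcal{F}^*(y)$, $y(0)=y_0$, $\|y\|_{W_T}\le M_{Y_0}$, and $(\mathbf{y}^*(y_0),\mathcal{F}^*(\mathbf{y}^*(y_0)))$ is a minimizer of $(P_{y_0})$. Approximation Assumption. Let $\varepsilon_0>0$. For each $0<\varepsilon\le\varepsilon_0$, $\mathcal{R}_\varepsilon\simeq\mathbb{R}^{N_\varepsilon}$ is a finite-dimensional parameter space with Hilbert norm $\|\cdot\|_{\mathcal{R}_\varepsilon}$, and $(\theta,t,y)\mapsto V^\varepsilon_\theta(t,y)$ belongs to $\mathcal{C}^4(\mathcal{R}_\varepsilon\times\mathbb{R}\times\mathbb{R}^n)$ with $V^\varepsilon_\theta(T,y)=\frac12|Q_2(y-y_d^T)|^2$ for all $y,\theta$. There are $\theta_\varepsilon\in\mathcal{R}_\varepsilon$ and $c>0$ independent of $\varepsilon$ such that $|V^\varepsilon_{\theta_\varepsilon}-V^*|+|\partial_y(V^\varepsilon_{\theta_\varepsilon}-V^* )|+\|\partial_{yy}(V^\varepsilon_{\theta_\varepsilon}-V^* )\|\le c\varepsilon$ on $\bar I\times\bar B_{2\widehat M}(0)$. Put $F^\varepsilon_\theta(t,y)=-\frac1\beta g(t,y)^\top\partial_yV^\varepsilon_\theta(t,y)$, $\mathcal{F}^\varepsilon_\theta(y)(t)=F^\varepsilon_\theta(t,y(t))$. Finite learning problem. Fix $y_0^1,\dots,y_0^N\in Y_0$, weights $\omega_i>0$, $\gamma_1,\gamma_2\ge0$,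 $\gamma_\varepsilon>0$; $\varepsilon$ is small enough that the admissible set is nonempty. Put $$J_\varepsilon(y,p,\theta)=J(y,\mathcal{F}^\varepsilon_\theta(y))+\int_0^T\tfrac{\gamma_1}2|V^\varepsilon_\theta(t,y(t))-J_t(y,\mathcal{F}^\varepsilon_\theta(y))|^2+\tfrac{\gamma_2}2|\partial_yV^\varepsilon_\theta(t,y(t))-p(t)|^2\,dt.$$ $(\mathcal{P}^N_\varepsilon)$: minimize $\sum_{i=1}^N\omega_iJ_\varepsilon(y_i,p_i,\theta)+\frac{\gamma_\varepsilon}2\|\theta\|^2_{\mathcal{R}_\varepsilon}$ over $y_i,p_i\in W_T$, $\theta\in\mathcal{R}_\varepsilon$ subject to, for $i=1,\dots,N$, $$\dot y_i=\mathbf{f}(y_i)+\mathbf{g}(y_i)\mathcal{F}^\varepsilon_\theta(y_i),\ y_i(0)=y_0^i,\quad -\dot p_i=D\mathbf{f}(y_i)^\top p_i+[D\mathbf{g}(y_i)^\top\mathcal{F}^\varepsilon_\theta(y_i)]p_i+\mathbf{Q}_1^\top\mathbf{Q}_1(y_i-y_d),\ p_i(T)=Q_2^\top Q_2(y_i(T)-y_d^T).$$ Here $D\mathbf{f}(y)^\top$ is pointwise multiplication by $D_yf(t,y(t))^\top$ and $([D\mathbf{g}(y)^\top u]p)_k=\sum_{i,j}\partial_{y_k}g_{ij}(t,y(t))u_j(t)p_i(t)$. An infimizing sequence is a sequence of admissible points along which the objective converges to its infimum over admissible points. *)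

(* Defs.v *)
From HB Require Import structures.
From mathcomp Require Import all_boot all_order all_algebra.
From mathcomp Require Import all_classical all_reals all_analysis.
From mathcomp Require Import ess_sup_inf.

Set Implicit Arguments.
Unset Strict Implicit.
Unset Printing Implicit Defensive.

Import Order.TTheory GRing.Theory Num.Theory.
Import numFieldNormedType.Exports.

Local Open Scope classical_set_scope.
Local Open Scope ring_scope.

(* The norm `|x| of the library on matrices is the max norm.  fnorm is the
   Frobenius norm, i.e. the Euclidean norm on column vectors. *)
Definition fnorm (R : realType) (p q : nat) (A : 'M[R]_(p, q)) : R :=
  Num.sqrt (\sum_i \sum_j A i j ^+ 2).

Definition cball0 (R : realType) (n : nat) (r : R) : set 'cV[R]_n :=
  [set y | fnorm y <= r].

Definition sym_psd (R : realType) (n : nat) (Q : 'M[R]_n) : Prop :=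
  Q^T = Q /\ forall x : 'cV[R]_n, 0 <= (x^T *m Q *m x) 0 0.

Definition inner_product (R : realType) (n : nat)
    (dot : 'cV[R]_n -> 'cV[R]_n -> R) : Prop :=
  [/\ forall x y, dot x y = dot y x,
      forall a x y z, dot (a *: x + y) z = a * dot x z + dot y z &
      forall x, x != 0 -> 0 < dot x x].

(* F is C^k on the open set O: all iterated directional derivatives up to order
   k exist and are continuous on O.  Meant for finite-dimensional E. *)
Fixpoint Ck_open (R : realType) (E W : normedModType R) (k : nat) (O : set E)
    (F : E -> W) : Prop :=
  (forall x, O x -> {for x, continuous F}) /\
  match k with
  | 0%N => True
  | k'.+1 => forall v : E,
      (forall x, O x -> derivable F x v) /\ Ck_open k' O (fun x => 'D_v F x)
  end.

(* F is C^k on an arbitrary set D: it is on D the restriction of a function of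
   class C^k on an open neighbourhood of D. *)
Definition Ck_on (R : realType) (E W : normedModType R) (k : nat) (D : set E)
    (F : E -> W) : Prop :=
  exists (O : set E) (G : E -> W),
    [/\ open O, D `<=` O, Ck_open k O G & forall x, D x -> G x = F x].

Definition grad (R : realType) (n : nat) (phi : 'cV[R]_n -> R) (y : 'cV[R]_n)
    : 'cV[R]_n :=
  \col_i 'D_(delta_mx i 0) phi y.

Definition hess (R : realType) (n : nat) (phi : 'cV[R]_n -> R) (y : 'cV[R]_n)
    : 'M[R]_n :=
  \matrix_(i, j) 'D_(delta_mx j 0) (fun z => 'D_(delta_mx i 0) phi z) y.

Definition jac (R : realType) (n p : nat) (F : 'cV[R]_n -> 'cV[R]_p)
    (y : 'cV[R]_n) : 'M[R]_(p, n) :=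
  \matrix_(i, j) 'D_(delta_mx j 0) (fun z => F z i 0) y.

Definition lipschitz_y (R : realType) (n p q : nat) (T : R) (K : set 'cV[R]_n)
    (G : R -> 'cV[R]_n -> 'M[R]_(p, q)) : Prop :=
  exists L : R, forall t y z, t \in `[0, T] -> K y -> K z ->
    fnorm (G t y - G t z) <= L * fnorm (y - z).

(* L^2 and H^1 on the interval (a, b).  Functions are total on R; only their
   values on (a, b) (resp. on [a, b] for H^1) are relevant. *)

Definition L2 (R : realType) (n : nat) (a b : R) (v : R -> 'cV[R]_n) : Prop :=
  (forall i, measurable_fun `]a, b[ (fun t => v t i 0)) /\
  (@lebesgue_measure R).-integrable `]a, b[ (fun t => (fnorm (v t) ^+ 2)%:E).

(* C^1 functions with compact support in (a, b). *)
Definition test_function (R : realType) (a b : R) (phi : R -> R) : Prop :=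
  [/\ forall t, derivable phi t 1,
      continuous (phi^`())%classic &
      exists K : set R, [/\ compact K, K `<=` `]a, b[ &
        forall t, ~ K t -> phi t = 0]].

(* v in L^2(a, b) is the weak derivative of y. *)
Definition weak_deriv (R : realType) (n : nat) (a b : R)
    (y v : R -> 'cV[R]_n) : Prop :=
  L2 a b v /\
  forall phi, test_function a b phi -> forall i : 'I_n,
    \int[@lebesgue_measure R]_(t in `]a, b[) (y t i 0 * (phi^`())%classic t) =
    - \int[@lebesgue_measure R]_(t in `]a, b[) (v t i 0 * phi t).

(* Elements of H^1(a, b) are represented by their continuous representative on
   [a, b], so that point values such as y(a) make sense.  W_T is H1 0 T. *)
Definition H1 (R : realType) (n : nat) (a b : R) (y : R -> 'cV[R]_n) : Prop :=
  [/\ L2 a b y, exists v, weak_deriv a b y v &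
      {within `[a, b], continuous y}].

Definition wder (R : realType) (n : nat) (a b : R) (y : R -> 'cV[R]_n)
    : R -> 'cV[R]_n :=
  xget (fun=> 0) [set v | weak_deriv a b y v].

Definition WT_norm (R : realType) (n : nat) (T : R) (y : R -> 'cV[R]_n) : R :=
  Num.sqrt
    (\int[@lebesgue_measure R]_(t in `]0, T[) (fnorm (wder 0 T y t) ^+ 2) +
     \int[@lebesgue_measure R]_(t in `]0, T[) (fnorm (y t) ^+ 2)).

Definition C0_norm (R : realType) (n : nat) (T : R) (y : R -> 'cV[R]_n) : R :=
  sup [set fnorm (y t) | t in `[0, T]].

(* Operator norm of the embedding of W_T into C([0, T]; R^n). *)
Definition embedding_norm (R : realType) (n : nat) (T : R) : R :=
  sup [set C0_norm T y | y in
        [set y : R -> 'cV[R]_n | H1 0 T y /\ WT_norm T y <= 1]].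

(* The function is set to 0 outside (a, b), which does not affect the essential
   supremum of a nonnegative function when a < b. *)
Definition Linfty_norm (R : realType) (n : nat) (a b : R) (y : R -> 'cV[R]_n)
    : \bar R :=
  ess_sup (@lebesgue_measure R)
    ((fun t => (fnorm (y t))%:E) \_ (`]a, b[ : set R)).

Record control_problem (R : realType) (n m : nat) := ControlProblem {
  horizon : R;
  dynf : R -> 'cV[R]_n -> 'cV[R]_n;
  dyng : R -> 'cV[R]_n -> 'M[R]_(n, m);
  costQ1 : 'M[R]_n;
  costQ2 : 'M[R]_n;
  beta : R;
  ydes : R -> 'cV[R]_n;
  ydesT : 'cV[R]_n }.

Definition standing_assumptions (R : realType) (n m : nat)
    (P : control_problem R n m) : Prop :=
  [/\ 0 < horizon P, sym_psd (costQ1 P), sym_psd (costQ2 P), 0 < beta P &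
      L2 0 (horizon P) (ydes P)].

Definition cost (R : realType) (n m : nat) (P : control_problem R n m) (t : R)
    (y : R -> 'cV[R]_n) (u : R -> 'cV[R]_m) : R :=
  2^-1 * \int[@lebesgue_measure R]_(s in `]t, horizon P[)
           (fnorm (costQ1 P *m (y s - ydes P s)) ^+ 2
            + beta P * fnorm (u s) ^+ 2)
  + 2^-1 * fnorm (costQ2 P *m (y (horizon P) - ydesT P)) ^+ 2.

Definition dynamics (R : realType) (n m : nat) (P : control_problem R n m)
    (y : R -> 'cV[R]_n) (u : R -> 'cV[R]_m) : R -> 'cV[R]_n :=
  fun t => dynf P t (y t) + dyng P t (y t) *m u t.

Definition controlled_trajectory (R : realType) (n m : nat)
    (P : control_problem R n m) (t0 : R) (y0 : 'cV[R]_n)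
    (y : R -> 'cV[R]_n) (u : R -> 'cV[R]_m) : Prop :=
  [/\ H1 t0 (horizon P) y, L2 t0 (horizon P) u,
      weak_deriv t0 (horizon P) y (dynamics P y u) & y t0 = y0].

Definition control_minimizer (R : realType) (n m : nat)
    (P : control_problem R n m) (y0 : 'cV[R]_n)
    (y : R -> 'cV[R]_n) (u : R -> 'cV[R]_m) : Prop :=
  controlled_trajectory P 0 y0 y u /\
  forall z v, controlled_trajectory P 0 y0 z v -> cost P 0 y u <= cost P 0 z v.

(* Extended-real valued: +oo when there is no admissible pair. *)
Definition value_function (R : realType) (n m : nat)
    (P : control_problem R n m) (t0 : R) (y0 : 'cV[R]_n) : \bar R :=
  ereal_inf [set (cost P t0 yu.1 yu.2)%:E | yu in
    [set yu | controlled_trajectory P t0 y0 yu.1 yu.2]].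

(* The feedback law - 1/beta g(t, y)^T d_y W(t, y) induced by W. *)
Definition feedback (R : realType) (n m : nat) (P : control_problem R n m)
    (W : R -> 'cV[R]_n -> R) (t : R) (y : 'cV[R]_n) : 'cV[R]_m :=
  - (beta P)^-1 *: ((dyng P t y)^T *m grad (W t) y).

Definition closed_loop_control (R : realType) (n m : nat)
    (P : control_problem R n m) (W : R -> 'cV[R]_n -> R)
    (y : R -> 'cV[R]_n) : R -> 'cV[R]_m :=
  fun t => feedback P W t (y t).

Definition Mhat (R : realType) (n m : nat) (P : control_problem R n m)
    (MY : R) : R := MY * embedding_norm n (horizon P).

Definition C2_lipschitz (R : realType) (n p q : nat) (T : R)
    (F : R -> 'cV[R]_n -> 'M[R]_(p, q)) : Prop :=
  Ck_on 2 [set x : R * 'cV[R]_n | x.1 \in `[0, T]] (fun x => F x.1 x.2) /\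
  forall K : set 'cV[R]_n, compact K -> forall i j,
    lipschitz_y T K (fun t => grad (fun z => F t z i j)) /\
    lipschitz_y T K (fun t => hess (fun z => F t z i j)).

Definition regularity_dynamics (R : realType) (n m : nat)
    (P : control_problem R n m) : Prop :=
  C2_lipschitz (horizon P) (dynf P) /\ C2_lipschitz (horizon P) (dyng P).

(* The value function is C^2 on D = [0, T] x (closed ball of radius 2 Mhat): V
   is a C^2 function on a neighbourhood of D which agrees with it on D.  Since D
   is the closure of its interior (if n > 0 and Mhat > 0), the derivatives of V
   at the points of D, i.e. the derivatives of the value function on D, do not
   depend on the choice of V. *)
Definition regularity_value (R : realType) (n m : nat)
    (P : control_problem R n m) (MY : R) (V : R -> 'cV[R]_n -> R) : Prop :=
  let D := [set x : R * 'cV[R]_n |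
              x.1 \in `[0, horizon P] /\ cball0 (2 * Mhat P MY) x.2] in
  [/\ 0 < MY,
      exists O : set (R * 'cV[R]_n), [/\ open O, D `<=` O &
        Ck_open 2 O (fun x => V x.1 x.2 : R)],
      forall t y, D (t, y) -> value_function P t y = (V t y)%:E,
      lipschitz_y (horizon P) (cball0 (2 * Mhat P MY)) (fun t => grad (V t)) &
      lipschitz_y (horizon P) (cball0 (2 * Mhat P MY)) (fun t => hess (V t))].

Definition closed_loop_state (R : realType) (n m : nat)
    (P : control_problem R n m) (MY : R) (V : R -> 'cV[R]_n -> R)
    (y0 : 'cV[R]_n) (y : R -> 'cV[R]_n) : Prop :=
  [/\ H1 0 (horizon P) y,
      weak_deriv 0 (horizon P) y (dynamics P y (closed_loop_control P V y)),
      y 0 = y0 & WT_norm (horizon P) y <= MY].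

Definition regularity_closed_loop (R : realType) (n m : nat)
    (P : control_problem R n m) (Y0 : set 'cV[R]_n) (MY : R)
    (V : R -> 'cV[R]_n -> R) : Prop :=
  forall y0, Y0 y0 -> exists y,
    [/\ closed_loop_state P MY V y0 y,
        forall z, closed_loop_state P MY V y0 z ->
          forall t, t \in `[0, horizon P] -> z t = y t &
        control_minimizer P y0 y (closed_loop_control P V y)].

Definition regularity_assumption (R : realType) (n m : nat)
    (P : control_problem R n m) (Y0 : set 'cV[R]_n) (MY : R)
    (V : R -> 'cV[R]_n -> R) : Prop :=
  [/\ regularity_dynamics P, regularity_value P MY V &
      regularity_closed_loop P Y0 MY V].

(* The parameter space for eps is R^(pdim eps) with the Hilbert norm of the inner
   product pdot eps; Vapp eps theta t y is the parametrized value function. *)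
Record approx_family (R : realType) (n : nat) := ApproxFamily {
  pdim : R -> nat;
  pdot : forall eps : R, 'cV[R]_(pdim eps) -> 'cV[R]_(pdim eps) -> R;
  Vapp : forall eps : R, 'cV[R]_(pdim eps) -> R -> 'cV[R]_n -> R }.

Definition approximation_assumption (R : realType) (n m : nat)
    (P : control_problem R n m) (MY : R) (V : R -> 'cV[R]_n -> R) (eps0 : R)
    (A : approx_family R n) : Prop :=
  [/\ 0 < eps0,
      forall eps, 0 < eps -> eps <= eps0 ->
        [/\ inner_product (@pdot _ _ A eps),
            Ck_open 4 [set: 'cV[R]_(pdim A eps) * R * 'cV[R]_n]
              (fun x => Vapp x.1.1 x.1.2 x.2 : R) &
            forall (theta : 'cV[R]_(pdim A eps)) (y : 'cV[R]_n),
              Vapp theta (horizon P) y =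
              2^-1 * fnorm (costQ2 P *m (y - ydesT P)) ^+ 2] &
      exists2 c : R, 0 < c & forall eps, 0 < eps -> eps <= eps0 ->
        exists theta : 'cV[R]_(pdim A eps), forall (t : R) (y : 'cV[R]_n),
          t \in `[0, horizon P] -> cball0 (2 * Mhat P MY) y ->
          `|Vapp theta t y - V t y|
          + fnorm (grad (Vapp theta t) y - grad (V t) y)
          + fnorm (hess (Vapp theta t) y - hess (V t) y) <= c * eps].

Record learning_data (R : realType) (n N : nat) := LearningData {
  init : 'I_N -> 'cV[R]_n;
  weight : 'I_N -> R;
  gamma1 : R;
  gamma2 : R;
  gammaeps : R }.

Definition learning_assumptions (R : realType) (n N : nat)
    (Y0 : set 'cV[R]_n) (L : learning_data R n N) : Prop :=
  [/\ forall i, Y0 (init L i), forall i, 0 < weight L i,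
      0 <= gamma1 L, 0 <= gamma2 L & 0 < gammaeps L].

Definition learning_cost (R : realType) (n m : nat)
    (P : control_problem R n m) (gamma1 gamma2 : R) (W : R -> 'cV[R]_n -> R)
    (y p : R -> 'cV[R]_n) : R :=
  let u := closed_loop_control P W y in
  cost P 0 y u +
  \int[@lebesgue_measure R]_(t in `]0, horizon P[)
    (gamma1 / 2 * `|W t (y t) - cost P t y u| ^+ 2
     + gamma2 / 2 * fnorm (grad (W t) (y t) - p t) ^+ 2).

Definition learning_objective (R : realType) (n m N : nat)
    (P : control_problem R n m) (A : approx_family R n)
    (L : learning_data R n N) (eps : R) (y p : 'I_N -> R -> 'cV[R]_n)
    (theta : 'cV[R]_(pdim A eps)) : R :=
  \sum_(i < N) weight L i *
     learning_cost P (gamma1 L) (gamma2 L) (Vapp theta) (y i) (p i)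
  + gammaeps L / 2 * pdot theta theta.

(* The matrix with k-th row ( sum_j d_{y_k} g_ij(t, y) u_j )_i . *)
Definition dg_adj (R : realType) (n m : nat) (P : control_problem R n m)
    (t : R) (y : 'cV[R]_n) (u : 'cV[R]_m) : 'M[R]_n :=
  \matrix_(k, i) \sum_j 'D_(delta_mx k 0) (fun z => dyng P t z i j) y * u j 0.

Definition adjoint_rhs (R : realType) (n m : nat) (P : control_problem R n m)
    (y : R -> 'cV[R]_n) (u : R -> 'cV[R]_m) (p : R -> 'cV[R]_n)
    : R -> 'cV[R]_n :=
  fun t => (jac (dynf P t) (y t))^T *m p t
           + dg_adj P t (y t) (u t) *m p t
           + (costQ1 P)^T *m costQ1 P *m (y t - ydes P t).

Definition learning_admissible (R : realType) (n m N : nat)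
    (P : control_problem R n m) (A : approx_family R n)
    (L : learning_data R n N) (eps : R) (y p : 'I_N -> R -> 'cV[R]_n)
    (theta : 'cV[R]_(pdim A eps)) : Prop :=
  forall i : 'I_N,
    let u := closed_loop_control P (Vapp theta) (y i) in
    [/\ H1 0 (horizon P) (y i) /\ H1 0 (horizon P) (p i),
        weak_deriv 0 (horizon P) (y i) (dynamics P (y i) u),
        y i 0 = init L i,
        weak_deriv 0 (horizon P) (p i)
          (fun t => - adjoint_rhs P (y i) u (p i) t) &
        p i (horizon P) =
          (costQ2 P)^T *m costQ2 P *m (y i (horizon P) - ydesT P)].

Definition learning_infimum (R : realType) (n m N : nat)
    (P : control_problem R n m) (A : approx_family R n)
    (L : learning_data R n N) (eps : R) : R :=
  inf [set c | exists y p (theta : 'cV[R]_(pdim A eps)),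
         learning_admissible P L y p theta /\
         c = learning_objective P L y p theta].

Definition infimizing_sequence (R : realType) (n m N : nat)
    (P : control_problem R n m) (A : approx_family R n)
    (L : learning_data R n N) (eps : R) (y p : nat -> 'I_N -> R -> 'cV[R]_n)
    (theta : nat -> 'cV[R]_(pdim A eps)) : Prop :=
  (forall k, learning_admissible P L (y k) (p k) (theta k)) /\
  (fun k => learning_objective P L (y k) (p k) (theta k)) @ \oo
    --> learning_infimum P A L eps.

Definition learning_minimizer (R : realType) (n m N : nat)
    (P : control_problem R n m) (A : approx_family R n)
    (L : learning_data R n N) (eps : R) (y p : 'I_N -> R -> 'cV[R]_n)
    (theta : 'cV[R]_(pdim A eps)) : Prop :=
  learning_admissible P L y p theta /\
  forall z q (eta : 'cV[R]_(pdim A eps)), learning_admissible P L z q eta ->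
    learning_objective P L y p theta <= learning_objective P L z q eta.

(* Main.v *)
Require Import Defs.
From mathcomp Require Import all_boot all_order all_algebra.
From mathcomp Require Import all_classical all_reals all_analysis.
From mathcomp Require Import measurable_realfun ess_sup_inf ring lra.
Import Order.TTheory GRing.Theory Num.Theory.
Import numFieldNormedType.Exports.
Local Open Scope classical_set_scope.
Local Open Scope ring_scope.

Set Implicit Arguments.
Unset Strict Implicit.
Unset Printing Implicit Defensive.

(** The direct method.  Along an infimizing sequence the term in gammaeps bounds
the parameters theta_k, which live in a finite-dimensional space.  Since the
states are bounded uniformly in k, the closed-loop vector fields are bounded
along them, so the states are equi-Lipschitz and Arzela-Ascoli applies.  The
costates solve linear equations whose matrices converge uniformly; Gronwall's
lemma bounds them and Arzela-Ascoli applies again.  The constraints and the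
objective pass to the limit, and the limit realizes the infimum.

Three choices keep the argument elementary.

Instead of extracting subsequences, limits are taken along one ultrafilter U
that refines the filter of cofinal sets of indices: along U every bounded
sequence of a finite-dimensional space converges, hence so do theta_k, all the
states and all the costates simultaneously, whereas the infimizing property is
kept ([ultra_bounded_cvg], [ultra_ascoli]).

Uniform convergence is encoded as continuous convergence, [ccvg]: u k x tends to
v t when k follows U and x tends to t, jointly.  On a segment this is equivalent
to uniform convergence to a continuous limit ([ccvg_uniform], [uniform_ccvg]),
but it is an ordinary filter limit, so it passes through every continuous
operation with no Lipschitz or uniform continuity estimate.  The data being of
class C^1 in the state is enough to make all coefficients of the optimality
system converge ([field_ccvg], [adjoint_matrix_ccvg], [grad_ccvg]).  A function
is continuous if and only if it is the continuous limit of the constant family,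
so these lemmas also give continuity of the coefficients for each fixed k.

The desired state y_d is only square integrable, so the costate equation has no
continuous right-hand side.  In the difference of two costates y_d cancels; hence
p_k - p_0 has a continuous weak derivative.  By the du Bois-Reymond lemma
[weak_deriv_continuous] it is then classically differentiable, which is what
Gronwall's lemma and the mean value theorem need.  In the costs y_d appears as a
fixed integrable factor of continuously converging functions, and such products
converge in L^1 ([ccvg_L1cvgM]). *)

(** * The squared Frobenius norm *)

Lemma fnorm2E {R : realType} p q (M : 'M[R]_(p, q)) :
  fnorm M ^+ 2 = \sum_i \sum_j M i j ^+ 2.
Proof.
rewrite /fnorm sqr_sqrtr//.
by apply: sumr_ge0 => i _; apply: sumr_ge0 => j _; exact: sqr_ge0.
Qed.

Lemma fnorm2E1 {R : realType} p (v : 'cV[R]_p) : fnorm v ^+ 2 = \sum_i v i 0 ^+ 2.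
Proof. by rewrite fnorm2E; apply: eq_bigr => i _; rewrite big_ord1. Qed.

(** * Continuous convergence along a filter *)

Section continuous_convergence.
Context {R : realType} (a b : R) {I : Type} (U : set_system I).

(** On a segment this amounts to uniform convergence towards a continuous limit,
but it is a plain filter limit and composes as such. *)
Definition ccvg {V : topologicalType} (u : I -> R -> V) (v : R -> V) : Prop :=
  forall t, t \in `[a, b] ->
    (fun z : R * I => u z.2 z.1) @ filter_prod (within `[a, b] (nbhs t)) U
      --> v t.

Context {FU : ProperFilter U}.

Lemma ccvg_ext {V : topologicalType} (u u' : I -> R -> V) (v v' : R -> V) :
  (forall k t, t \in `[a, b] -> u k t = u' k t) ->
  (forall t, t \in `[a, b] -> v t = v' t) ->
  ccvg u v -> ccvg u' v'.
Proof.
move=> uu' vv' uv t tab; rewrite -vv'//.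
apply: cvg_trans (uv t tab); apply: near_eq_cvg.
exists (`[a, b]%classic, setT) => /=; last first.
  by move=> [x k] [/= xab _]; exact: uu'.
by split; [rewrite /within/=; near=> x|exact: filterT].
Unshelve. all: by end_near. Qed.

Lemma ccvg_pointwise {V : topologicalType} (u : I -> R -> V) (v : R -> V) t :
  ccvg u v -> t \in `[a, b] -> (fun k => u k t) @ U --> v t.
Proof.
move=> uv tab W /(uv t tab) [[A B]/= [nA UB] AB].
apply: (@filterS _ U _ B) => // k Bk; have : (A `*` B) (t, k).
  by split => //=; move: nA => /nbhs_singleton; apply.
by move=> /AB.
Qed.

Lemma ccvg_const {V : topologicalType} (w : R -> V) :
  {within `[a, b], continuous w} -> ccvg (fun=> w) w.
Proof.
move=> /subspace_continuousP cw t tab.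
have := cw t tab; apply: cvg_comp; exact: cvg_fst.
Qed.

Lemma ccvg_param {V : topologicalType} (c : I -> V) (d : V) :
  c @ U --> d -> ccvg (fun k _ => c k) (fun=> d).
Proof. by move=> cd t _; apply: cvg_comp cd; exact: cvg_snd. Qed.

Lemma ccvg_pair {V W : topologicalType} (u : I -> R -> V) v
    (u' : I -> R -> W) v' :
  ccvg u v -> ccvg u' v' ->
  ccvg (fun k t => (u k t, u' k t)) (fun t => (v t, v' t)).
Proof. by move=> uv uv' t tab; apply: cvg_pair; [exact: uv|exact: uv']. Qed.

Lemma ccvg_comp {V W : topologicalType} (G : V -> W) (u : I -> R -> V) v :
  (forall t, t \in `[a, b] -> {for v t, continuous G}) ->
  ccvg u v -> ccvg (fun k t => G (u k t)) (fun t => G (v t)).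
Proof. by move=> cG uv t tab; apply: cvg_comp (uv t tab) (cG t tab). Qed.

Section normed.
Context {V : normedModType R}.
Implicit Types (u : I -> R -> V) (v : R -> V).

Lemma ccvgD u v u' v' : ccvg u v -> ccvg u' v' ->
  ccvg (fun k t => u k t + u' k t) (fun t => v t + v' t).
Proof. by move=> uv uv' t tab; apply: cvgD; [exact: uv|exact: uv']. Qed.

Lemma ccvgN u v : ccvg u v -> ccvg (fun k t => - u k t) (fun t => - v t).
Proof. by move=> uv t tab; apply: cvgN; exact: uv. Qed.

Lemma ccvgB u v u' v' : ccvg u v -> ccvg u' v' ->
  ccvg (fun k t => u k t - u' k t) (fun t => v t - v' t).
Proof. by move=> uv /ccvgN uv'; exact: ccvgD. Qed.

Lemma ccvgZ (c : R) u v : ccvg u v ->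
  ccvg (fun k t => c *: u k t) (fun t => c *: v t).
Proof. by move=> uv t tab; apply: cvgZl_tmp; exact: uv. Qed.

Lemma ccvg_sum (J : finType) (u : J -> I -> R -> V) (v : J -> R -> V) :
  (forall j, ccvg (u j) (v j)) ->
  ccvg (fun k t => \sum_j u j k t) (fun t => \sum_j v j t).
Proof.
move=> uv t tab; apply: (cvg_big (op := +%R)) => [|j _]; [exact: add_continuous|exact: uv].
Qed.

(** Letting k go to its limit first in the joint limit bounds v x - v t. *)
Lemma ccvg_continuous u v : ccvg u v -> {within `[a, b], continuous v}.
Proof.
move=> uv; apply/subspace_continuousP => t tab.
apply/cvgrPdist_le => e e0.
have /cvgrPdist_le/(_ _ (divr_gt0 e0 (ltr0n _ 2))) := uv t tab.
move=> [[A B]/= [nA UB] AB].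
rewrite near_withinE; move: nA.
apply: (@filterS _ (nbhs t)) => x Ax xab; move: (Ax xab) => {}Ax.
have ux := ccvg_pointwise uv xab.
have /cvgrPdist_le/(_ _ (divr_gt0 e0 (ltr0n _ 2))) := ux.
move=> Ux; have [k [Bk uk]] := filter_ex (filterI UB Ux).
rewrite (splitr e) -(subrKA (u k x)); apply: le_trans (ler_normD _ _) _.
by rewrite lerD//; [exact: (AB (x, k))|rewrite distrC].
Qed.

(** The segment is compact, so the indices that are good near each of its points
can be chosen good for all of them. *)
Lemma ccvg_uniform u v : ccvg u v -> forall e, 0 < e ->
  \forall k \near U, forall t, t \in `[a, b] -> `|u k t - v t| <= e.
Proof.
move=> uv e e0; have /subspace_continuousP cv := ccvg_continuous uv.
have e20 : 0 < e / 2 by rewrite divr_gt0.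
have /compact_near_coveringP/near_covering_withinP := @segment_compact R a b.
move=> /(_ _ U (fun k t => `|u k t - v t| <= e) _); apply => t tab.
have /cvgrPdist_le/(_ _ e20) [[A B]/= [nA UB] AB] := uv t tab.
have /cvgrPdist_le/(_ _ e20) nA' := cv t tab.
exists ([set x | `[a, b]%classic x -> A x /\ `|v t - v x| <= e / 2], B) => /=.
  split => //.
  move: nA nA'; apply: (@filterS2 _ (nbhs t)) => x h1 h2 xab.
  by split; [exact: h1|exact: h2].
move=> [x k] [/= + Bk xab] => /(_ xab)[Ax vx].
rewrite (splitr e) -(subrKA (v t)); apply: le_trans (ler_normD _ _) _.
by rewrite lerD//; rewrite distrC; exact: (AB (x, k)).
Qed.

Lemma uniform_ccvg u v : {within `[a, b], continuous v} ->
  (forall e, 0 < e ->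
    \forall k \near U, forall t, t \in `[a, b] -> `|u k t - v t| <= e) ->
  ccvg u v.
Proof.
move=> /subspace_continuousP cv uv t tab; apply/cvgrPdist_le => e e0.
have e20 : 0 < e / 2 by rewrite divr_gt0.
have /cvgrPdist_le/(_ _ e20) nA := cv t tab.
exists ([set x | `[a, b]%classic x /\ `|v t - v x| <= e / 2],
  [set k | forall t, t \in `[a, b] -> `|u k t - v t| <= e / 2]) => /=.
  by split; [move: nA; apply: (@filterS _ (nbhs t)) => x vx xab; split => //;
    exact: vx|exact: uv].
move=> [x k] [/= [xab vx] uk].
rewrite (splitr e) -(subrKA (v x)); apply: le_trans (ler_normD _ _) _.
by rewrite lerD// distrC uk.
Qed.

Lemma ccvg_bounded u v : ccvg u v ->
  exists C, 0 < C /\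
    \forall k \near U, forall t, t \in `[a, b] -> `|u k t| <= C.
Proof.
move=> uv; have cv := ccvg_continuous uv.
have /compact_bounded [M [Mr HM]] : compact (v @` `[a, b]).
  by apply: continuous_compact => //; exact: segment_compact.
have M1 : M < `|M| + 1 by rewrite (le_lt_trans (ler_norm _))// ltrDl.
exists (`|M| + 1 + 1); split; first by rewrite !ltr_wpDl// addr_ge0.
apply: filterS (ccvg_uniform uv ltr01) => k uk t tab.
rewrite -[u k t](subrK (v t)) addrC [leRHS]addrC.
rewrite addrC; apply: le_trans (ler_normD _ _) _.
by rewrite lerD ?uk//; apply: (HM _ M1); exists t.
Qed.

(** The Ascoli step: equicontinuity upgrades pointwise convergence. *)
Lemma ccvg_equilipschitz u v L :
  (forall t, t \in `[a, b] -> (fun k => u k t) @ U --> v t) ->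
  (\forall k \near U, forall s t, s \in `[a, b] -> t \in `[a, b] ->
     `|u k s - u k t| <= L * `|s - t|) ->
  ccvg u v.
Proof.
move=> uv lipu t tab; apply/cvgrPdist_le => e e0.
have e20 : 0 < e / 2 by rewrite divr_gt0.
have /cvgrPdist_le/(_ _ e20) ut := uv t tab.
(* L may be zero or negative, hence the norm and the added 1. *)
pose d := e / 2 / (`|L| + 1).
have d0 : 0 < d by rewrite divr_gt0// ltr_wpDl.
exists ([set x | `[a, b]%classic x /\ `|x - t| <= d],
  [set k | `|v t - u k t| <= e / 2 /\
     forall s t, s \in `[a, b] -> t \in `[a, b] ->
     `|u k s - u k t| <= L * `|s - t|]) => /=.
  split; last exact: filterS2 ut lipu.
  have /cvgrPdist_le/(_ _ d0) := @cvg_id _ (nbhs t).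
  by apply: (@filterS _ (nbhs t)) => x; rewrite distrC => xt xab.
move=> [x k] [/= [xab xt] [ukt Lk]].
rewrite (splitr e) -(subrKA (u k t)); apply: le_trans (ler_normD _ _) _.
rewrite lerD// distrC (le_trans (Lk x t xab tab))//.
apply: (@le_trans _ _ ((`|L| + 1) * d)); last first.
  by rewrite /d mulrC divfK// gt_eqF// ltr_wpDl.
rewrite (@le_trans _ _ (`|L| * `|x - t|))// ?ler_wpM2r ?ler_norm//.
by rewrite ler_pM// lerDl.
Qed.

End normed.

Section scalar.
Implicit Types (u : I -> R -> R) (v : R -> R).

Lemma ccvgM u v u' v' : ccvg u v -> ccvg u' v' ->
  ccvg (fun k t => u k t * u' k t) (fun t => v t * v' t).
Proof. by move=> uv uv' t tab; apply: cvgM; [exact: uv|exact: uv']. Qed.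

Lemma ccvgMl c u v : ccvg u v -> ccvg (fun k t => c * u k t) (fun t => c * v t).
Proof. by move=> uv t tab; apply: cvgMl_tmp; exact: uv. Qed.

End scalar.

Section matrix.
Context {p q : nat}.

Lemma ccvg_coord (u : I -> R -> 'M[R]_(p, q)) (v : R -> 'M[R]_(p, q)) i j :
  ccvg u v -> ccvg (fun k t => u k t i j) (fun t => v t i j).
Proof.
apply: (@ccvg_comp _ _ (fun M : 'M[R]_(p, q) => M i j)) => t _.
exact: coord_continuous.
Qed.

Lemma cvg_matrix {T : Type} (F : set_system T) (FF : Filter F)
    (f : T -> 'M[R]_(p, q)) (M : 'M[R]_(p, q)) :
  (forall i j, (fun x => f x i j) @ F --> M i j) -> f @ F --> M.
Proof.
move=> fM; apply/cvg_ballP => e e0.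
have : \forall x \near F, forall ij : 'I_p * 'I_q,
    ball (M ij.1 ij.2) e (f x ij.1 ij.2).
  by apply: filter_forall => -[i j]/=; move/cvg_ballP: (fM i j); apply.
by apply: filterS => x h; split => // i j; exact: (h (i, j)).
Qed.

Lemma ccvg_matrix (u : I -> R -> 'M[R]_(p, q)) (v : R -> 'M[R]_(p, q)) :
  (forall i j, ccvg (fun k t => u k t i j) (fun t => v t i j)) -> ccvg u v.
Proof.
by move=> uv t tab; apply: cvg_matrix => i j; exact: uv.
Qed.

End matrix.

Lemma ccvg_mulmx {p q r : nat} (u : I -> R -> 'M[R]_(p, q)) v
    (u' : I -> R -> 'M[R]_(q, r)) v' :
  ccvg u v -> ccvg u' v' ->
  ccvg (fun k t => u k t *m u' k t) (fun t => v t *m v' t).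
Proof.
move=> uv uv'; apply: ccvg_matrix => i j.
apply: (@ccvg_ext _ (fun k t => \sum_l u k t i l * u' k t l j) _
   (fun t => \sum_l v t i l * v' t l j)); try by move=> *; rewrite mxE.
by apply: ccvg_sum => l; apply: ccvgM; exact: ccvg_coord.
Qed.

Lemma ccvg_trmx {p q : nat} (u : I -> R -> 'M[R]_(p, q)) v :
  ccvg u v -> ccvg (fun k t => (u k t)^T) (fun t => (v t)^T).
Proof.
move=> uv; apply: ccvg_matrix => i j.
apply: (@ccvg_ext _ (fun k t => u k t j i) _ (fun t => v t j i));
  try by move=> *; rewrite mxE.
exact: ccvg_coord.
Qed.

Lemma ccvg_fnorm2 {p q : nat} (u : I -> R -> 'M[R]_(p, q)) v :
  ccvg u v -> ccvg (fun k t => fnorm (u k t) ^+ 2) (fun t => fnorm (v t) ^+ 2).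
Proof.
move=> uv; apply: (@ccvg_ext _ (fun k t => \sum_i \sum_j u k t i j ^+ 2) _
   (fun t => \sum_i \sum_j v t i j ^+ 2)); try by move=> *; rewrite fnorm2E.
apply: ccvg_sum => i; apply: ccvg_sum => j.
by apply: ccvgM; exact: ccvg_coord.
Qed.

End continuous_convergence.

(** * Integrable functions and convergence in L^1 on an interval *)

Section integrals.
Context {R : realType} (a b : R).
Notation mu := (@lebesgue_measure R).
Notation intble f := (mu.-integrable `]a, b[ (EFin \o (f : R -> R))).
Implicit Types (f g h w : R -> R).

Lemma intbleD f g : intble f -> intble g -> intble (fun t => f t + g t).
Proof. by move=> fi gi; exact: (integrableD _ fi gi). Qed.

Lemma intbleN f : intble f -> intble (fun t => - f t).
Proof. by move=> fi; exact: (integrableN fi). Qed.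

Lemma intbleB f g : intble f -> intble g -> intble (fun t => f t - g t).
Proof. by move=> fi /intbleN; exact: intbleD. Qed.

Lemma intbleZ c f : intble f -> intble (fun t => c * f t).
Proof. by move=> fi; exact: (integrableZl _ c fi). Qed.

Lemma eq_intble f g : (forall t, t \in `]a, b[ -> f t = g t) ->
  intble f -> intble g.
Proof.
by move=> fg; apply: eq_integrable => // t; rewrite inE /= => tab; rewrite fg.
Qed.

Lemma le_intble f g : measurable_fun `]a, b[ f ->
  (forall t, t \in `]a, b[ -> `|f t| <= g t) -> intble g -> intble f.
Proof.
move=> mf fg; apply: le_integrable => //; first exact/measurable_EFinP.
by move=> t /= tab; rewrite lee_fin (le_trans (fg t tab))// ler_norm.
Qed.

Lemma intble_measurable f : intble f -> measurable_fun `]a, b[ f.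
Proof. by move=> fi; apply/measurable_EFinP; exact: (measurable_int mu). Qed.


Lemma intble_norm f : intble f -> intble (fun t => `|f t|).
Proof. by move=> fi; exact: integrable_norm. Qed.

Lemma within_intble w : {within `[a, b], continuous w} -> intble w.
Proof.
move=> cw; have := continuous_compact_integrable (@segment_compact R a b) cw.
apply: integrableS => //; exact: subset_itv_oo_cc.
Qed.

Lemma intble_cc f : intble f -> mu.-integrable `[a, b] (EFin \o f).
Proof.
move=> /integrableP[mf fi].
have mf' : measurable_fun `[a, b] (EFin \o f).
  exact/emeasurable_fun_itv_obnd_cbndP/emeasurable_fun_itv_bndo_bndcP.
apply/integrableP; split => //.
rewrite -integral_itv_obnd_cbnd; last first.
  by apply/emeasurable_fun_itv_bndo_bndcP; exact: measurableT_comp.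
by rewrite -integral_itv_bndo_bndc//; exact: measurableT_comp.
Qed.

Lemma cst_intble (c : R) : intble (fun=> c).
Proof.
by apply: within_intble; apply: continuous_subspaceT => x; exact: cvg_cst.
Qed.

Lemma intble_sum (J : finType) (f : J -> R -> R) :
  (forall j, intble (f j)) -> intble (fun t => \sum_j f j t).
Proof.
move=> fi; rewrite (_ : (fun _ => _) = \sum_j f j); last first.
  by apply/funext => t; rewrite fct_sumE.
apply: (big_ind (fun f => intble f)) => //; last by move=> *; exact: intbleD.
exact: cst_intble.
Qed.

Lemma within_bounded w : {within `[a, b], continuous w} ->
  exists C, 0 < C /\ forall t, t \in `[a, b] -> `|w t| <= C.
Proof.
move=> cw; have /compact_bounded [M [Mr HM]] : compact (w @` `[a, b]).
  by apply: continuous_compact => //; exact: segment_compact.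
exists (`|M| + 1); split; first by rewrite ltr_wpDl.
move=> t tab; apply: (HM (`|M| + 1)); last by exists t.
by rewrite (le_lt_trans (ler_norm _))// ltrDl.
Qed.

Lemma intbleM w h : {within `[a, b], continuous w} -> intble h ->
  intble (fun t => w t * h t).
Proof.
move=> cw hi; have [C [C0 wC]] := within_bounded cw.
apply: (@le_intble _ (fun t => C * `|h t|)).
- by apply: measurable_funM; apply: intble_measurable => //; exact: within_intble.
- move=> t /= tab; rewrite normrM.
  by rewrite ler_wpM2r// wC//; exact: subset_itv_oo_cc.
- by apply: intbleZ; exact: intble_norm.
Qed.

(** The scalar form of [L2], which is stable under linear combinations without
any triangle inequality for the Frobenius norm. *)
Definition sqint f := measurable_fun `]a, b[ f /\ intble (fun t => f t ^+ 2).

Lemma sqintM f g : sqint f -> sqint g -> intble (fun t => f t * g t).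
Proof.
move=> [mf fi] [mg gi].
apply: (@le_intble _ (fun t => f t ^+ 2 + g t ^+ 2)).
- exact: measurable_funM.
- move=> t _; rewrite normrM.
  rewrite -(real_normK (num_real (f t))) -(real_normK (num_real (g t))).
  by have := sqr_ge0 (`|f t| - `|g t|); nra.
- exact: intbleD.
Qed.

Lemma within_sqint w : {within `[a, b], continuous w} -> sqint w.
Proof.
move=> cw; split; first by apply: intble_measurable; exact: within_intble.
apply: (@eq_intble (fun t => w t * w t)).
  by move=> t _; rewrite expr2.
by apply: intbleM => //; exact: within_intble.
Qed.

Lemma sqint_intble f : sqint f -> intble f.
Proof.
move=> fi; apply: (@eq_intble (fun t => f t * 1)).
  by move=> t _; rewrite mulr1.
apply: sqintM => //; apply: within_sqint.
by apply: continuous_subspaceT => x; exact: cvg_cst.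
Qed.

Lemma sqintD f g : sqint f -> sqint g -> sqint (fun t => f t + g t).
Proof.
move=> fi gi; split; first by case: fi gi => ? _ [? _]; exact: measurable_funD.
apply: (@eq_intble (fun t => f t ^+ 2 + 2 * (f t * g t) + g t ^+ 2)).
  by move=> t _; ring.
apply: intbleD; [apply: intbleD|]; [by case: fi| |by case: gi].
by apply: intbleZ; exact: sqintM.
Qed.

Lemma sqintZ c f : sqint f -> sqint (fun t => c * f t).
Proof.
move=> [mf fi]; split.
  by apply: measurable_funM => //; exact: measurable_cst.
apply: (@eq_intble (fun t => c ^+ 2 * f t ^+ 2)).
  by move=> t _; ring.
exact: intbleZ.
Qed.

Lemma sqint_sum (J : finType) (f : J -> R -> R) :
  (forall j, sqint (f j)) -> sqint (fun t => \sum_j f j t).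
Proof.
move=> fi; rewrite (_ : (fun _ => _) = \sum_j f j); last first.
  by apply/funext => t; rewrite fct_sumE.
apply: (big_ind sqint) => //; last by move=> *; exact: sqintD.
by apply: within_sqint; apply: continuous_subspaceT => x; exact: cvg_cst.
Qed.

Lemma L2P p (v : R -> 'cV[R]_p) : L2 a b v <-> forall i, sqint (fun t => v t i 0).
Proof.
split=> [[mv vi] i|vi].
  split => //; apply: le_intble vi; first exact: measurable_funX.
  move=> t _; rewrite ger0_norm ?sqr_ge0//.
  rewrite fnorm2E1 (bigD1 i)//= lerDl.
  by apply: sumr_ge0 => *; exact: sqr_ge0.
split => [i|]; first by case: (vi i).
apply: (@eq_intble (fun t => \sum_i v t i 0 ^+ 2)).
  by move=> t _; rewrite fnorm2E1.
by apply: intble_sum => i; case: (vi i).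
Qed.

Section L1.
Context {I : Type} (U : set_system I) {FU : ProperFilter U}.
Implicit Types (u : I -> R -> R) (v : R -> R).

Definition L1cvg (u : I -> R -> R) (v : R -> R) : Prop :=
  [/\ forall k, intble (u k), intble v & forall e, 0 < e -> \forall k \near U,
    \int[mu]_(t in `]a, b[) `|u k t - v t| <= e].

Lemma L1cvg_ext u u' v v' :
  (forall k t, t \in `]a, b[ -> u k t = u' k t) ->
  (forall t, t \in `]a, b[ -> v t = v' t) ->
  L1cvg u v -> L1cvg u' v'.
Proof.
move=> uu' vv' [ui vi uv]; split.
- by move=> k; apply: eq_intble (ui k) => t; exact: uu'.
- exact: eq_intble vi.
- move=> e /uv; apply: filterS => k; apply: le_trans.
  rewrite le_eqVlt; apply/orP; left; apply/eqP; apply: eq_Rintegral => t.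
  by rewrite inE /= => tab; rewrite uu'// vv'.
Qed.

Lemma L1cvgD u v u' v' : L1cvg u v -> L1cvg u' v' ->
  L1cvg (fun k t => u k t + u' k t) (fun t => v t + v' t).
Proof.
move=> [ui vi uv] [ui' vi' uv']; split; [by move=> k; exact: intbleD|exact: intbleD|].
move=> e e0; have e20 : 0 < e / 2 by rewrite divr_gt0.
apply: filterS2 (uv _ e20) (uv' _ e20) => k h h'.
rewrite (splitr e); apply: le_trans (lerD h h'); rewrite -RintegralD//.
- apply: le_Rintegral => //.
  + by apply: intble_norm; apply: intbleB; exact: intbleD.
  + by apply: intbleD; apply: intble_norm; exact: intbleB.
  + by move=> t _; rewrite opprD addrACA ler_normD.
- by apply: intble_norm; exact: intbleB.
- by apply: intble_norm; exact: intbleB.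
Qed.

Lemma L1cvg_cst v : intble v -> L1cvg (fun=> v) v.
Proof.
move=> vi; split => // e e0; near=> k.
under eq_Rintegral do rewrite subrr normr0.
by rewrite Rintegral_cst// mul0r ltW.
Unshelve. all: by end_near. Qed.

Lemma L1cvg_sum (J : finType) (u : J -> I -> R -> R) (v : J -> R -> R) :
  (forall j, L1cvg (u j) (v j)) ->
  L1cvg (fun k t => \sum_j u j k t) (fun t => \sum_j v j t).
Proof.
move=> uv; have H (s : seq J) :
  L1cvg (fun k t => \sum_(j <- s) u j k t) (fun t => \sum_(j <- s) v j t).
  elim: s => [|j s ih].
    apply: (@L1cvg_ext (fun _ _ => 0) _ (fun=> 0)); try by move=> *; rewrite big_nil.
    by apply: L1cvg_cst; exact: cst_intble.
  apply: L1cvg_ext (L1cvgD (uv j) ih); by move=> *; rewrite big_cons.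
exact: H.
Qed.

Lemma L1cvg_cont_mul u v w : {within `[a, b], continuous w} -> L1cvg u v ->
  L1cvg (fun k t => w t * u k t) (fun t => w t * v t).
Proof.
move=> cw [ui vi uv]; split; [by move=> k; exact: intbleM|exact: intbleM|].
have [C [C0 wC]] := within_bounded cw.
move=> e e0; apply: filterS (uv _ (divr_gt0 e0 C0)) => k h.
apply: (@le_trans _ _ (\int[mu]_(t in `]a, b[) (C * `|u k t - v t|))).
- apply: le_Rintegral => //.
  + by apply: intble_norm; apply: intbleB; exact: intbleM.
  + by apply: intbleZ; apply: intble_norm; exact: intbleB.
  + move=> t tab; rewrite -mulrBr normrM ler_wpM2r// wC//.
    exact: subset_itv_oo_cc.
- rewrite RintegralZl//; last by apply: intble_norm; exact: intbleB.
  by rewrite mulrC -ler_pdivlMr.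
Qed.

Lemma L1cvgZ c u v : L1cvg u v ->
  L1cvg (fun k t => c * u k t) (fun t => c * v t).
Proof.
by apply: L1cvg_cont_mul; apply: continuous_subspaceT => x; exact: cvg_cst.
Qed.

(** The difference is at most a small constant times the norm of h. *)
Lemma ccvg_L1cvgM u v h : (forall k, {within `[a, b], continuous (u k)}) ->
  ccvg a b U u v -> intble h ->
  L1cvg (fun k t => u k t * h t) (fun t => v t * h t).
Proof.
move=> cu uv hi; have cv : {within `[a, b], continuous v} by exact: ccvg_continuous uv.
split; [by move=> k; exact: intbleM|exact: intbleM|].
pose C := \int[mu]_(t in `]a, b[) `|h t|.
have C0 : 0 <= C by apply: Rintegral_ge0 => t _.
move=> e e0; have C10 : 0 < C + 1 by rewrite ltr_wpDl.
apply: filterS (ccvg_uniform uv (divr_gt0 e0 C10)) => k h1.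
apply: (@le_trans _ _ (\int[mu]_(t in `]a, b[) (e / (C + 1) * `|h t|))).
- apply: le_Rintegral => //.
  + by apply: intble_norm; apply: intbleB; exact: intbleM.
  + by apply: intbleZ; exact: intble_norm.
  + move=> t tab; rewrite -mulrBl normrM ler_wpM2r// h1//.
    exact: subset_itv_oo_cc.
- rewrite RintegralZl//; last exact: intble_norm.
  by rewrite -/C mulrAC ler_pdivrMr// ler_pM2l// lerDl.
Qed.

Lemma ccvg_L1cvg u v : (forall k, {within `[a, b], continuous (u k)}) ->
  ccvg a b U u v -> L1cvg u v.
Proof.
move=> cu uv; apply: L1cvg_ext (ccvg_L1cvgM cu uv (cst_intble 1));
  by move=> *; rewrite mulr1.
Qed.

(** This serves the cost-to-go, whose lower integration bound is the time at which
it is compared with the value function.  The error is at most the L^1 distance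
whatever the bound, and the limit depends continuously on the bound. *)
Lemma L1cvg_tail u v : a <= b -> L1cvg u v ->
  ccvg a b U (fun k t => \int[mu]_(s in `]t, b[) u k s)
             (fun t => \int[mu]_(s in `]t, b[) v s).
Proof.
move=> ab [ui vi uv]; pose F x := \int[mu]_(s in `]x, b[) v s.
have sub x : x \in `[a, b] -> `]x, b[ `<=` `]a, b[.
  by move=> xab; apply: subset_itvr; rewrite bnd_simp (itvP xab).
apply: uniform_ccvg.
  have vcc : mu.-integrable `[a, b] (EFin \o v) by exact: intble_cc.
  have FE : {in `[a, b]%classic, (fun x => \int[mu]_(s in `[a, b]) v s
      - parameterized_integral mu a x v) =1 F}.
    move=> x; rewrite inE /= => xab; rewrite /parameterized_integral /F.
    rewrite Rintegral_itvB ?bnd_simp ?(itvP xab)//.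
    apply/esym/Rintegral_itv_bndo_bndc; apply: integrableS vi => //.
    exact: sub.
  apply: (@subspace_eq_continuous _ _ _ _ _ FE); apply/subspace_continuousP => x xab.
  apply: cvgB; first exact: cvg_cst.
  have /subspace_continuousP := parameterized_integral_continuous ab vcc.
  exact.
move=> e /uv; apply: filterS => k h t tab.
have tsub := sub t tab.
have H f : intble f -> mu.-integrable `]t, b[ (EFin \o f).
  by apply: integrableS.
rewrite -RintegralB//; [|exact: H..].
apply: le_trans h; apply: le_trans (le_normr_Rintegral _ _) _ => //.
  by apply: H; exact: intbleB.
rewrite /Rintegral fine_le//.
- apply: integrable_fin_num => //; apply: H; apply: intble_norm; exact: intbleB.
- apply: integrable_fin_num => //; apply: intble_norm; exact: intbleB.
- apply: ge0_subset_integral => //.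
  by apply: (measurable_int mu); apply: intble_norm; exact: intbleB.
Qed.

Lemma L1cvg_integral u v : L1cvg u v ->
  (fun k => \int[mu]_(s in `]a, b[) u k s) @ U --> \int[mu]_(s in `]a, b[) v s.
Proof.
move=> [ui vi uv]; apply/cvgrPdist_le => e e0.
apply: filterS (uv _ e0) => k; apply: le_trans.
rewrite -RintegralB//; apply: le_trans (le_normr_Rintegral _ _) _ => //.
  exact: intbleB.
by under eq_Rintegral do rewrite distrC.
Qed.

End L1.
End integrals.

(** * Continuous weak derivatives are classical derivatives *)

Section test_functions.
Context {R : realType}.
Notation mu := (@lebesgue_measure R).

Definition weak_primitive (a b : R) (w v : R -> R) : Prop :=
  forall phi, test_function a b phi ->
    \int[mu]_(t in `]a, b[) (w t * (phi^`())%classic t) =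
    - \int[mu]_(t in `]a, b[) (v t * phi t).

Lemma test_function_continuous (a b : R) phi :
  test_function a b phi -> continuous phi /\ continuous (phi^`())%classic.
Proof.
move=> [dphi c' _]; split => // x.
by apply/differentiable_continuous/derivable1_diffP.
Qed.

End test_functions.

Section weak_derivatives.
Context {R : realType} (a b : R) (ab : a < b).
Notation mu := (@lebesgue_measure R).
Implicit Types (g h v w : R -> R).

(** The set where w exceeds M is open in the segment, so if it is nonempty it
contains an interval, which is not negligible. *)
Lemma ae_le_within w (M : R) : {within `[a, b], continuous w} ->
  (\forall x \ae mu, x \in `]a, b[ -> w x <= M) ->
  forall x, x \in `[a, b] -> w x <= M.
Proof.
move=> cw [N [mN N0 wN]].
have /continuous_within_itvP -/(_ ab)[cwo cwa cwb] := cw.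
have wo x : x \in `]a, b[ -> w x <= M.
  move=> xab; rewrite leNgt; apply/negP => Mwx.
  have nM : \forall y \near x, M < w y by exact: (cvgr_gt (w x) (cwo _ xab)).
  have nI : \forall y \near x, y \in `]a, b[.
    by apply: near_in_itvoo.
  have /nbhs_ballP[e /= e0 eS] :
      \forall y \near x, M < w y /\ y \in `]a, b[ by exact: filterI.
  have : (mu `](x - e)%R, (x + e)%R[%classic <= mu N)%E.
    apply: le_measure; rewrite ?inE// => y; rewrite /= in_itv/= => /andP[y1 y2].
    apply: wN => /= H; have [+ yab] : M < w y /\ y \in `]a, b[.
      by apply: eS; rewrite /ball /= distrC ltr_distl y1 y2.
    by rewrite ltNge H.
  rewrite N0 lebesgue_measure_itv/= lte_fin ifT; last first.
    by rewrite ltrBlDr -addrA ltrDl addr_gt0.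
  by rewrite -EFinB lee_fin leNgt; move: e0; set A := (X in _ -> X) => e0; rewrite /A; lra.
move=> x; rewrite in_itv/= => /andP[].
rewrite le_eqVlt => /predU1P[<- _|ax].
  apply: (cvgr_to_le cwa); near=> y; apply: wo; rewrite in_itv/=; apply/andP.
  by split; near: y; [exact: nbhs_right_gt|exact: nbhs_right_lt].
rewrite le_eqVlt => /predU1P[->|xb].
  apply: (cvgr_to_le cwb); near=> y; apply: wo; rewrite in_itv/=; apply/andP.
  by split; near: y; [exact: nbhs_left_gt|exact: nbhs_left_lt].
by apply: wo; rewrite in_itv/= ax xb.
Unshelve. all: by end_near. Qed.

(** Together with the sign hypothesis, g vanishes on the open interval. *)
Lemma integral_eq0_within g : {within `[a, b], continuous g} ->
  (forall x, x \in `]a, b[ -> 0 <= g x) -> \int[mu]_(x in `]a, b[) g x = 0 ->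
  forall x, x \in `[a, b] -> g x <= 0.
Proof.
move=> cg g0 ig0; apply: ae_le_within => //.
have gi := within_intble cg.
have mg : measurable_fun `]a, b[ (EFin \o g) by exact: (measurable_int mu).
have [+ _] := ae_eq_integral_abs mu (measurable_itv _) mg.
have -> : (\int[mu]_(x in `]a, b[) `|(EFin \o g) x| = 0)%E.
  under eq_integral => x do [rewrite inE /= => xab; rewrite ger0_norm ?g0//].
  by rewrite -[LHS]fineK ?integrable_fin_num//; congr EFin.
move=> /(_ erefl); apply: filterS => x /= H xab.
by have [->] := H xab.
Qed.

(** The primitive of psi vanishes to the left of the support, and to its right
because the total integral is zero. *)
Lemma bump_primitive (psi : R -> R) (s t : R) : a < s -> s < t -> t < b ->
  continuous psi -> (forall x, x \notin `]s, t[ -> psi x = 0) ->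
  \int[mu]_(x in `]a, b[) psi x = 0 ->
  exists2 phi, test_function a b phi & (phi^`())%classic = psi.
Proof.
move=> as_ st tb cpsi psi0 ipsi.
have psiE (D : set R) : `]s, t[ `<=` D -> psi \_ D = psi.
  move=> sD; apply/funext => x; rewrite patchE; case: ifPn => // xD.
  rewrite psi0//; apply: contra xD => xst; rewrite inE; exact: sD.
have psii (D : set R) : measurable D -> mu.-integrable D (EFin \o psi).
  move=> mD; apply: (@integrableS _ _ _ mu setT) => //.
  have -> : EFin \o psi = (EFin \o psi) \_ `[s, t].
    rewrite -[in LHS](psiE `[s, t]%classic); last exact: subset_itv_oo_cc.
    by apply/funext => x; rewrite /= !patchE; case: ifP.
  apply/integrable_restrict => //; rewrite setTI.
  apply: continuous_compact_integrable; first exact: segment_compact.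
  exact: continuous_subspaceT.
pose phi x := \int[mu]_(y in `]-oo, x]) psi y.
have dphi x : derivable phi x 1 /\ (phi^`())%classic x = psi x.
  apply: (@continuous_FTC1 _ psi -oo%O x (x + 1)) => //.
  - by rewrite ltrDl.
  - exact: psii.
  - by rewrite ltNyr.
  - exact: cpsi.
have phi'E : (phi^`())%classic = psi by apply/funext => x; case: (dphi x).
exists phi => //; split; [by move=> x; case: (dphi x)|by rewrite phi'E|].
exists `[s, t]%classic; split; first exact: segment_compact.
  move=> x /=; rewrite !in_itv/= => /andP[sx xt].
  by rewrite (lt_le_trans as_ sx) (le_lt_trans xt tb).
move=> x /negP; rewrite in_itv/= negb_and -!ltNge => /orP[xs|tx].
  rewrite /phi Rintegral_mkcond (_ : _ \_ _ = cst 0) ?Rintegral_cst ?mul0r//.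
  apply/funext => y; rewrite patchE; case: ifPn => //=; rewrite inE/= in_itv/= => yx.
  by rewrite psi0// in_itv/= negb_and -!leNgt (le_trans yx (ltW xs)).
rewrite /phi Rintegral_mkcond psiE; last first.
  by move=> y /=; rewrite !in_itv/= => /andP[_ yt]; rewrite ltW// (lt_trans yt).
move: ipsi; rewrite Rintegral_mkcond psiE// => y /=; rewrite !in_itv/=.
by move=> /andP[sy yt]; rewrite (lt_trans as_ sy) (lt_trans yt tb).
Qed.

(** Clamping extends a function continuous on the segment to the whole line. *)
Lemma clamp_continuous w : {within `[a, b], continuous w} ->
  continuous (fun x => w (Num.max a (Num.min b x))).
Proof.
move=> /subspace_continuousP cw x.
pose c (y : R) : R := Num.max a (Num.min b y).
have cab y : `[a, b]%classic (c y).
  by rewrite /= in_itv/= /c le_max lexx/= ge_max ltW//= ge_min lexx.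
have cc : {for x, continuous c}.
  apply: (@continuous_max _ _ (fun=> a) (fun y => Num.min b y)).
    exact: cvg_cst.
  apply: (@continuous_min _ _ (fun=> b) id); first exact: cvg_cst.
  exact: cvg_id.
move=> W /(cw _ (cab x)) nW.
have : nbhs x (c @^-1` [set y | `[a, b]%classic y -> W (w y)]) by exact: cc.
by apply: (@filterS _ (nbhs x)) => y; apply; exact: cab.
Qed.

Lemma bump_function (s t : R) : a < s -> s < t -> t < b ->
  exists eta : R -> R, [/\ continuous eta, forall x, 0 <= eta x,
      forall x, x \notin `]s, t[ -> eta x = 0,
      forall x, x \in `]s, t[ -> 0 < eta x &
      \int[mu]_(x in `]a, b[) eta x != 0].
Proof.
move=> as_ st tb; pose eta x := Num.max 0 ((x - s) * (t - x)).
have ceta : continuous eta.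
  move=> x; apply: (@continuous_max _ _ (fun=> 0) (fun y => (y - s) * (t - y))).
    exact: cvg_cst.
  apply: cvgM; first by apply: cvgB; [exact: cvg_id|exact: cvg_cst].
  by apply: cvgB; [exact: cvg_cst|exact: cvg_id].
have eta0 x : 0 <= eta x by rewrite le_max lexx.
have etap x : x \in `]s, t[ -> 0 < eta x.
  rewrite in_itv/= => /andP[sx xt].
  by rewrite lt_max; apply/orP; right; rewrite mulr_gt0 ?subr_gt0.
exists eta; split => //.
  move=> x; rewrite in_itv/= negb_and -!leNgt => h; apply/max_idPl.
  case/orP: h => h.
    have [xt|tx] := leP x t; first by rewrite mulr_le0_ge0 ?subr_le0 ?subr_ge0.
    by have := lt_trans st (lt_le_trans tx h); rewrite ltxx.
  have [xs|sx] := leP x s; last by rewrite mulr_ge0_le0 ?subr_le0 ?subr_ge0// ltW.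
  by have := lt_le_trans st (le_trans h xs); rewrite ltxx.
apply/eqP => /(integral_eq0_within (continuous_subspaceT ceta) (fun x _ => eta0 x)).
have mst : (s + t) / 2 \in `]s, t[ by rewrite in_itv/= !midf_lt.
move=> /(_ ((s + t) / 2)); rewrite leNgt etap// => H.
suff /H : (s + t) / 2 \in `[a, b] by [].
move: mst; rewrite !in_itv/= => /andP[h1 h2].
by rewrite (ltW (lt_trans as_ h1)) (ltW (lt_trans h2 tb)).
Qed.

(** The lemma of du Bois-Reymond.  Let V be a primitive of v, h = w - V, eta a bump
supported between s and t, and k the mean of h with weight eta.  Then (h - k) eta has
zero integral, hence is the derivative of a test function; testing with it and
integrating V by parts shows that the integral of (h - k)^2 eta vanishes.
Therefore w = V + k between s and t. *)
Lemma weak_deriv_continuous w v :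
  {within `[a, b], continuous w} -> {within `[a, b], continuous v} ->
  weak_primitive a b w v ->
  forall x, x \in `]a, b[ -> is_derive x 1 w (v x).
Proof.
move=> cw cv wv x0 x0ab.
pose c (y : R) : R := Num.max a (Num.min b y).
have cE x : x \in `[a, b] -> c x = x.
  rewrite in_itv/= => /andP[ax xb].
  by rewrite /c (min_idPr xb) (max_idPr ax).
pose v1 := v \o c.
have cv1 : continuous v1 by exact: clamp_continuous.
(* Integrating the clamped v from a - 1 makes V differentiable at a and b too. *)
pose V x := \int[mu]_(y in `[a - 1, x]) v1 y.
have dV x : x \in `[a, b] -> derivable V x 1 /\ (V^`())%classic x = v1 x.
  rewrite in_itv/= => /andP[ax xb].
  apply: (@continuous_FTC1_closed _ v1 (a - 1) x (b + 1)).
  - by rewrite (le_lt_trans xb)// ltrDl.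
  - apply: continuous_compact_integrable; first exact: segment_compact.
    exact: continuous_subspaceT.
  - by rewrite (lt_le_trans _ ax)// ltrBlDr ltrDl.
  - exact: cv1.
have cV : {within `[a, b], continuous V}.
  by apply: derivable_within_continuous => x /dV[].
pose h := (fun x => w (c x) - V (c x)).
have ch : continuous h.
  move=> x; apply: cvgB; [exact: (clamp_continuous cw)|exact: (clamp_continuous cV)].
pose s := (a + x0) / 2; pose t := (x0 + b) / 2.
have [as_ sx0 x0t tb] : [/\ a < s, s < x0, x0 < t & t < b].
  by move: x0ab; rewrite in_itv/= => /andP[? ?]; rewrite /s /t !midf_lt.
have st : s < t := lt_trans sx0 x0t.
have [eta [ceta eta0 etaN etap Ieta]] := bump_function as_ st tb.
pose k := (\int[mu]_(x in `]a, b[) (h x * eta x)) / \int[mu]_(x in `]a, b[) eta x.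
have cI (f : R -> R) : continuous f -> mu.-integrable `]a, b[ (EFin \o f).
  by move=> cf; apply: within_intble; exact: continuous_subspaceT.
pose psi x := (h x - k) * eta x.
have cpsi : continuous psi.
  move=> x; apply: cvgM; last exact: ceta.
  by apply: cvgB; [exact: ch|exact: cvg_cst].
have cheta : continuous (fun x => h x * eta x).
  by move=> x; apply: cvgM; [exact: ch|exact: ceta].
have ipsi : \int[mu]_(x in `]a, b[) psi x = 0.
  rewrite /psi; under eq_Rintegral do rewrite mulrBl.
  rewrite RintegralB//; [|exact: cI|by apply: intbleZ; exact: cI].
  by rewrite RintegralZl//; [rewrite /k divfK// subrr|exact: cI].
have psiN x : x \notin `]s, t[ -> psi x = 0.
  by move=> /etaN xst; rewrite /psi xst mulr0.
have [phi tphi phi'E] := bump_primitive as_ st tb cpsi psiN ipsi.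
have [cphi _] := test_function_continuous tphi.
have [phia phib] : phi a = 0 /\ phi b = 0.
  case: tphi => _ _ [K [_ Kab K0]].
  by split; apply: K0 => /Kab /=; rewrite in_itv/= ltxx ?andbF.
(* phi vanishes at both ends, so no boundary term remains. *)
have parts : \int[mu]_(x in `]a, b[) (V x * psi x) =
    - \int[mu]_(x in `]a, b[) (v x * phi x).
  have toC f : mu.-integrable `]a, b[ (EFin \o f) ->
      \int[mu]_(x in `]a, b[) f x = \int[mu]_(x in `[a, b]) f x.
    move=> fi; rewrite Rintegral_itv_obnd_cbnd//.
    apply: Rintegral_itv_bndo_bndc; apply: integrableS (intble_cc fi) => //.
    by apply: subset_itvl; rewrite bnd_simp.
  have cvphi : {within `[a, b], continuous (fun x => v x * phi x)}.
    move=> x; apply: continuousM; first exact: cv.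
    exact: continuous_subspaceT.
  have cVpsi : {within `[a, b], continuous (fun x => V x * psi x)}.
    move=> x; apply: continuousM; first exact: cV.
    exact: continuous_subspaceT.
  rewrite toC; last exact: within_intble.
  rewrite toC; last exact: within_intble.
  have /continuous_within_itvP -/(_ ab)[_ cVa cVb] := cV.
  rewrite (@Rintegration_by_parts _ V phi v psi)//.
  - by rewrite phia phib !mulr0 subrr sub0r.
  - by split => // x xab; case: (dV x (subset_itv_oo_cc xab)).
  - move=> x xab; have [_ ->] := dV x (subset_itv_oo_cc xab).
    by rewrite /v1 /= cE//; exact: subset_itv_oo_cc.
  - exact: continuous_subspaceT.
  - have dphi x : derivable phi x 1 by case: tphi.
    by split => [x _||]; [exact: dphi|apply: cvg_at_right_filter; exact: cphi|
      apply: cvg_at_left_filter; exact: cphi].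
  - by move=> x _; rewrite phi'E.
have Z : \int[mu]_(x in `]a, b[) ((h x - k) ^+ 2 * eta x) = 0.
  rewrite (_ : (fun x => _) = (fun x => h x * psi x - k * psi x)); last first.
    by apply/funext => x; rewrite /psi; ring.
  have chpsi : continuous (fun x => h x * psi x).
    by move=> x; apply: cvgM; [exact: ch|exact: cpsi].
  rewrite RintegralB//; [|exact: cI|by apply: intbleZ; exact: cI].
  rewrite RintegralZl//; last exact: cI.
  rewrite ipsi mulr0 subr0.
  have cwpsi : {within `[a, b], continuous (fun x => w x * psi x)}.
    move=> x; apply: continuousM; first exact: cw.
    exact: continuous_subspaceT.
  have cVpsi : {within `[a, b], continuous (fun x => V x * psi x)}.
    move=> x; apply: continuousM; first exact: cV.
    exact: continuous_subspaceT.
  have -> : \int[mu]_(x in `]a, b[) (h x * psi x) =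
      \int[mu]_(x in `]a, b[) (w x * psi x - V x * psi x).
    apply: eq_Rintegral => x; rewrite inE/= => xab.
    by rewrite /h cE ?mulrBl//; exact: subset_itv_oo_cc.
  rewrite RintegralB//; [|exact: within_intble..].
  by rewrite parts -phi'E wv// subrr.
have cZ : continuous (fun x => (h x - k) ^+ 2 * eta x).
  move=> x; apply: cvgM; last exact: ceta.
  by rewrite expr2; apply: cvgM; (apply: cvgB; [exact: ch|exact: cvg_cst]).
have hk x : x \in `]s, t[ -> h x = k.
  move=> xst; have xab : x \in `[a, b].
    move: xst; rewrite !in_itv/= => /andP[h1 h2].
    by rewrite (ltW (lt_trans as_ h1)) (ltW (lt_trans h2 tb)).
  have := integral_eq0_within (continuous_subspaceT cZ) _ Z xab.
  rewrite pmulr_lle0 ?etap// => H.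
  apply/eqP; rewrite -subr_eq0 -sqrf_eq0 eq_le sqr_ge0 andbT H//.
  by move=> y _; rewrite mulr_ge0 ?sqr_ge0.
have [dVx Vx] := dV _ (subset_itv_oo_cc x0ab).
have -> : v x0 = (V^`())%classic x0 + 0.
  by rewrite Vx addr0 /v1 /= cE//; exact: subset_itv_oo_cc.
apply: (@near_eq_is_derive _ _ _ (fun x => V x + k)).
  have : \forall y \near x0, y \in `]s, t[.
    by apply: near_in_itvoo; rewrite in_itv/= sx0.
  apply: filterS => x xst; rewrite -(hk _ xst) /h cE; first by rewrite addrC subrK.
  move: xst; rewrite !in_itv/= => /andP[h1 h2].
  by rewrite (ltW (lt_trans as_ h1)) (ltW (lt_trans h2 tb)).
apply: is_deriveD; rewrite derive1E; exact: derivableP.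
Qed.

End weak_derivatives.

(** * Differential inequalities *)

Section differential_inequalities.
Context {R : realType} (a b : R).

Lemma bounded_derive_lipschitz (w v : R -> R) (C : R) :
  {within `[a, b], continuous w} ->
  (forall x, x \in `]a, b[ -> is_derive x 1 w (v x)) ->
  (forall x, x \in `]a, b[ -> `|v x| <= C) ->
  forall s t, s \in `[a, b] -> t \in `[a, b] -> `|w s - w t| <= C * `|s - t|.
Proof.
move=> cw dw vC.
have main s t : s \in `[a, b] -> t \in `[a, b] -> s < t ->
    `|w s - w t| <= C * `|s - t|.
  move=> sab tab st.
  have sub : `]s, t[ `<=` `]a, b[.
    by apply: subset_itvW; rewrite ?(itvP sab) ?(itvP tab).
  have dws x : x \in `]s, t[ -> is_derive x 1 w (v x) by move/sub; exact: dw.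
  have cws : {within `[s, t], continuous w}.
    apply: continuous_subspaceW cw => x /=.
    rewrite !in_itv/= => /andP[sx xt].
    by rewrite (le_trans _ sx) ?(le_trans xt) ?(itvP sab) ?(itvP tab).
  have [c cst e] := @MVT R w v s t st dws cws.
  rewrite distrC e normrM (distrC s) ler_wpM2r// vC//.
  exact: sub.
move=> s t sab tab; have [st|ts|->] := ltgtP s t; first exact: main.
  by rewrite distrC (distrC s); exact: main.
by rewrite !subrr normr0 mulr0.
Qed.

Lemma sum_norm_sqr_le (n : nat) (c : 'I_n -> R) :
  (\sum_i `|c i|) ^+ 2 <= n%:R * \sum_i c i ^+ 2.
Proof.
have -> : n%:R * \sum_i c i ^+ 2 =
    \sum_i \sum_j 2^-1 * (c i ^+ 2 + c j ^+ 2).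
  rewrite [RHS](eq_bigr (fun i => 2^-1 * (n%:R * c i ^+ 2 + \sum_j c j ^+ 2))).
    rewrite -mulr_sumr big_split/= -mulr_sumr sumr_const card_ord.
    by rewrite -[X in _ + X]mulr_natl; field.
  move=> i _; rewrite -mulr_sumr big_split/= sumr_const card_ord.
  by rewrite -[X in X + _]mulr_natl.
rewrite expr2 mulr_suml; apply: ler_sum => i _; rewrite mulr_sumr.
apply: ler_sum => j _.
rewrite -(real_normK (num_real (c i))) -(real_normK (num_real (c j))).
by have := sqr_ge0 (`|c i| - `|c j|); nra.
Qed.

(** The squared Euclidean norm E of w satisfies E' + K (E + 1) >= 0, so
(E + 1) exp (K x) is nondecreasing.  The bound runs from the right end since the
costate has a terminal condition. *)
Lemma gronwall_backward (n : nat) (w v : 'I_n -> R -> R) (C : R) : 0 <= C ->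
  (forall i, {within `[a, b], continuous (w i)}) ->
  (forall i x, x \in `]a, b[ -> is_derive x 1 (w i) (v i x)) ->
  (forall i x, x \in `]a, b[ -> `|v i x| <= C * (1 + \sum_j `|w j x|)) ->
  forall x, x \in `[a, b] ->
    \sum_i w i x ^+ 2 + 1 <=
    (\sum_i w i b ^+ 2 + 1) * expR (C * (3 * n%:R + 1) * (b - x)).
Proof.
move=> C0 cw dw vC x xab.
have ab : a <= b by have := xab; rewrite in_itv/= => /andP[]; exact: le_trans.
set K := C * (3 * n%:R + 1).
pose E x := \sum_i w i x ^+ 2 + 1.
pose G x := E x * expR (K * x).
have cE : {within `[a, b], continuous E}.
  move=> y; apply: cvgD; last exact: cvg_cst.
  apply: (cvg_big (op := +%R)) => [|i _]; first exact: add_continuous.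
  by rewrite expr2; apply: cvgM; exact: cw.
have dE y : y \in `]a, b[ -> is_derive y 1 E (\sum_i 2 * (w i y * v i y)).
  move=> yab; rewrite (_ : E = (\sum_i (w i * w i)) + cst 1); last first.
    by apply/funext => z; rewrite /E /= fctE fct_sumE.
  rewrite -[X in is_derive _ _ _ X]addr0; apply: is_deriveD.
  apply: is_derive_sum => i; apply: is_derive_eq.
    by apply: is_deriveM; exact: dw.
  by rewrite /GRing.scale/=; ring.
have E'K y : y \in `]a, b[ -> 0 <= \sum_i 2 * (w i y * v i y) + K * E y.
  move=> yab; pose S := \sum_j `|w j y|; pose Q := \sum_j w j y ^+ 2.
  have S0 : 0 <= S by apply: sumr_ge0.
  have SQ : S ^+ 2 <= n%:R * Q by rewrite sum_norm_sqr_le.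
  have Q0 : 0 <= Q by apply: sumr_ge0 => i _; exact: sqr_ge0.
  (* 2 S (1 + S) <= 1 + 3 S^2 and S^2 <= n Q give the constant 3 n + 1 of K. *)
  have : - (2 * (C * (1 + S)) * S) <= \sum_i 2 * (w i y * v i y).
    rewrite /S mulr_sumr -sumrN; apply: ler_sum => i _; rewrite lerNl.
    rewrite -mulrN -mulrA ler_pM2l// (le_trans (ler_norm _))// normrN normrM.
    by rewrite [leRHS]mulrC ler_wpM2l// vC.
  rewrite /K /E -/Q; set X := \sum_(i < n) _ => XS.
  have CQ : C * S ^+ 2 <= C * (n%:R * Q) by rewrite ler_wpM2l.
  have CS : 0 <= C * (S - 1) ^+ 2 by rewrite mulr_ge0 ?sqr_ge0.
  have Cn : 0 <= C * n%:R by rewrite mulr_ge0.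
  have CQ0 : 0 <= C * Q by rewrite mulr_ge0.
  by nra.
have dG y : y \in `]a, b[ ->
    is_derive y 1 G ((\sum_i 2 * (w i y * v i y) + K * E y) * expR (K * y)).
  move=> yab; rewrite (_ : G = E * (expR \o (K \*: id))); last first.
    by apply/funext => z; rewrite /G /= fctE.
  apply: is_derive_eq; first by apply: is_deriveM; exact: dE.
  by rewrite /GRing.scale/=; ring.
have cG : {within `[a, b], continuous G}.
  move=> y; apply: continuousM; first exact: cE.
  apply: continuous_subspaceT => z.
  apply: continuous_comp; last exact: continuous_expR.
  by apply: cvgMl_tmp; exact: cvg_id.
have : G x <= G b.
  apply: (@ger0_derive1_le_cc _ G a b) => //.
  - by move=> y /dG [].
  - move=> y yab; rewrite derive1E; case: (dG y yab) => _ ->.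
    by rewrite mulr_ge0 ?expR_ge0// E'K.
  - by rewrite in_itv/= lexx ab.
  - by rewrite (itvP xab).
rewrite /G -/(E x) -/(E b) => h.
by rewrite mulrBr expRD expRN mulrA ler_pdivlMr ?expR_gt0.
Qed.

End differential_inequalities.

(** * Convergence of the coefficients of the optimality system *)

Section coefficients.
Context {R : realType}.

(** Regularity is assumed jointly in all variables, while the gradients and
Jacobians freeze time and parameter; both sides are the limit of the same
quotient. *)
Lemma derive_snd (E1 E2 W : normedModType R) (G : E1 * E2 -> W) (x : E1)
    (z e : E2) :
  'D_e (fun z => G (x, z)) z = 'D_((0, e) : E1 * E2) G (x, z).
Proof.
rewrite /derive (_ : (fun h => _) = (fun h : R =>
  h^-1 *: ((G \o shift (x, z)) (h *: ((0, e) : E1 * E2)) - G (x, z))))//.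
apply/funext => h /=.
congr (_ *: (G _ - _)); apply: injective_projections => //=.
by rewrite scaler0 add0r.
Qed.

Lemma derive_coord (E : normedModType R) p q (F : E -> 'M[R]_(p, q)) (x e : E)
    i j : derivable F x e -> 'D_e (fun z => F z i j) x = ('D_e F x) i j.
Proof.
move=> dF; apply: cvg_lim => //.
have : (fun h : R => (h^-1 *: ((F \o shift x) (h *: e) - F x)) i j) @ 0^' -->
    ('D_e F x) i j.
  apply: (@cvg_comp _ _ _ _ (fun M : 'M[R]_(p, q) => M i j) _ (nbhs ('D_e F x))).
    exact: dF.
  exact: coord_continuous.
by apply: cvg_trans; apply: near_eq_cvg; near=> h; rewrite !mxE.
Unshelve. all: by end_near. Qed.

Section fixed_interval.
Context (T : R) {I : Type} (U : set_system I) {FU : ProperFilter U}.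
Let D n := [set x : R * 'cV[R]_n | x.1 \in `[0, T]].

Lemma ccvg_id : ccvg 0 T U (fun=> id) id.
Proof. by apply: ccvg_const; apply: continuous_subspaceT => x; exact: cvg_id. Qed.

Lemma Ck_on_ccvg n p q k (F : R -> 'cV[R]_n -> 'M[R]_(p, q)) y ystar :
  Ck_on k (@D n) (fun x => F x.1 x.2) -> ccvg 0 T U y ystar ->
  ccvg 0 T U (fun k t => F t (y k t)) (fun t => F t (ystar t)).
Proof.
case=> Om [G [oO DO cG GF]] yy.
have cG0 : forall x, Om x -> {for x, continuous G} by case: k cG => [|k] [].
apply: (@ccvg_ext _ _ _ _ _ _ _ (fun k t => G (t, y k t)) _
    (fun t => G (t, ystar t))).
- by move=> j t tT; rewrite GF.
- by move=> t tT; rewrite GF.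
- apply: (ccvg_comp (G := G)); last by apply: ccvg_pair => //; exact: ccvg_id.
  by move=> t tT; apply/cG0/DO.
Qed.

(** For each time of the segment the slice of the domain is the whole state space,
so F and its smooth extension have the same partial derivatives there. *)
Lemma Ck_on_partial_ccvg n p q k (F : R -> 'cV[R]_n -> 'M[R]_(p, q)) y ystar
    i j e :
  Ck_on k.+1 (@D n) (fun x => F x.1 x.2) -> ccvg 0 T U y ystar ->
  ccvg 0 T U (fun k t => 'D_e (fun z => F t z i j) (y k t))
    (fun t => 'D_e (fun z => F t z i j) (ystar t)).
Proof.
case=> Om [G [oO DO [cG /(_ (0, e))[dG CG]] GF]] yy.
have cG0 : forall x, Om x -> {for x, continuous ('D_(0, e) G)}.
  by case: k CG {dG cG} => [|k] [].
have DE t z : t \in `[0, T] ->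
    'D_e (fun z => F t z i j) z = ('D_(0, e) G (t, z)) i j.
  move=> tT; rewrite -derive_coord; last by apply/dG/DO.
  apply: etrans (derive_snd (fun x => G x i j) t z e); congr ('D_e _ _).
  by apply/funext => z'; rewrite GF.
apply: (@ccvg_ext _ _ _ _ _ _ _ (fun k t => ('D_(0, e) G (t, y k t)) i j) _
    (fun t => ('D_(0, e) G (t, ystar t)) i j)).
- by move=> l t tT; rewrite DE.
- by move=> t tT; rewrite DE.
- apply: ccvg_coord; apply: (ccvg_comp (G := 'D_(0, e) G)).
    by move=> t tT; apply/cG0/DO.
  by apply: ccvg_pair => //; exact: ccvg_id.
Qed.

Section value_family.
Context {d n : nat} (W : 'cV[R]_d -> R -> 'cV[R]_n -> R) (l : nat).
Hypothesis CW :
  Ck_open l.+1 [set: 'cV[R]_d * R * 'cV[R]_n] (fun x => W x.1.1 x.1.2 x.2 : R).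
Context (theta : I -> 'cV[R]_d) (thetas : 'cV[R]_d) (y : I -> R -> 'cV[R]_n)
  (ystar : R -> 'cV[R]_n).
Hypotheses (thetaP : theta @ U --> thetas) (yP : ccvg 0 T U y ystar).

Let ccvg_point :
  ccvg 0 T U (fun k t => ((theta k, t), y k t)) (fun t => ((thetas, t), ystar t)).
Proof.
by apply: ccvg_pair => //; apply: ccvg_pair; [exact: ccvg_param|exact: ccvg_id].
Qed.

Lemma value_ccvg :
  ccvg 0 T U (fun k t => W (theta k) t (y k t)) (fun t => W thetas t (ystar t)).
Proof.
case: CW => cW _.
apply: (ccvg_comp (G := fun x : 'cV[R]_d * R * 'cV[R]_n => W x.1.1 x.1.2 x.2)
  _ ccvg_point).
by move=> t _; exact: cW.
Qed.

Lemma grad_ccvg : ccvg 0 T U (fun k t => grad (W (theta k) t) (y k t))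
  (fun t => grad (W thetas t) (ystar t)).
Proof.
apply: ccvg_matrix => i j; case: CW => _ /(_ (0, delta_mx i 0))[dW CdW].
pose G := 'D_(0, delta_mx i 0)
  (fun x : 'cV[R]_d * R * 'cV[R]_n => W x.1.1 x.1.2 x.2 : R).
have cG : forall x, {for x, continuous G} by case: l CdW {dW} => [|m] [] + _ x; exact.
have GE th t z : G (th, t, z) = (grad (W th t) z) i j.
  rewrite mxE /G -(derive_snd
    (fun x : 'cV[R]_d * R * 'cV[R]_n => W x.1.1 x.1.2 x.2 : R)) //.
apply: (@ccvg_ext _ _ _ _ _ _ _ (fun k t => G ((theta k, t), y k t)) _
  (fun t => G ((thetas, t), ystar t))).
- by move=> k t _; exact: GE.
- by move=> t _; exact: GE.
- by apply: (ccvg_comp (G := G) _ ccvg_point) => t _; exact: cG.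
Qed.

End value_family.
End fixed_interval.

Section closed_loop.
Context {d n m : nat} (P : control_problem R n m).
Context (W : 'cV[R]_d -> R -> 'cV[R]_n -> R) (l : nat).
Notation T := (horizon P).
Hypothesis regP : regularity_dynamics P.
Hypothesis CW :
  Ck_open l.+1 [set: 'cV[R]_d * R * 'cV[R]_n] (fun x => W x.1.1 x.1.2 x.2 : R).

Definition closed_loop_field (theta : 'cV[R]_d) (y : R -> 'cV[R]_n) :=
  dynamics P y (closed_loop_control P (W theta) y).

(** The matrix by which the costate is multiplied in the adjoint equation. *)
Definition adjoint_matrix (theta : 'cV[R]_d) (y : R -> 'cV[R]_n) (t : R)
    : 'M[R]_n :=
  (jac (dynf P t) (y t))^T
  + dg_adj P t (y t) (closed_loop_control P (W theta) y t).

Context {I : Type} (U : set_system I) {FU : ProperFilter U}.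
Context (theta : I -> 'cV[R]_d) (thetas : 'cV[R]_d) (y : I -> R -> 'cV[R]_n)
  (ystar : R -> 'cV[R]_n).
Hypotheses (thetaP : theta @ U --> thetas) (yP : ccvg 0 T U y ystar).

Lemma control_ccvg :
  ccvg 0 T U (fun k => closed_loop_control P (W (theta k)) (y k))
    (closed_loop_control P (W thetas) ystar).
Proof.
case: regP => _ [Cg _].
apply: ccvgZ; apply: ccvg_mulmx.
  by apply: ccvg_trmx; exact: Ck_on_ccvg Cg yP.
exact: (grad_ccvg CW).
Qed.

Lemma field_ccvg :
  ccvg 0 T U (fun k => closed_loop_field (theta k) (y k))
    (closed_loop_field thetas ystar).
Proof.
case: regP => [[Cf _] [Cg _]]; apply: ccvgD; first exact: Ck_on_ccvg Cf yP.
by apply: ccvg_mulmx; [exact: Ck_on_ccvg Cg yP|exact: control_ccvg].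
Qed.

Lemma adjoint_matrix_ccvg :
  ccvg 0 T U (fun k => adjoint_matrix (theta k) (y k))
    (adjoint_matrix thetas ystar).
Proof.
case: regP => [[Cf _] [Cg _]]; apply: ccvg_matrix => i j.
pose A th (z : R -> 'cV[R]_n) t :=
  'D_(delta_mx i 0) (fun z => dynf P t z j 0) (z t)
  + \sum_k 'D_(delta_mx i 0) (fun z => dyng P t z j k) (z t)
      * closed_loop_control P (W th) z t k 0.
have AE th z t : A th z t = adjoint_matrix th z t i j by rewrite !mxE.
apply: (@ccvg_ext _ _ _ _ _ _ _ (fun k t => A (theta k) (y k) t) _
  (fun t => A thetas ystar t)); [by move=> *; exact: AE..|].
apply: ccvgD; first exact: (@Ck_on_partial_ccvg _ _ _ FU _ _ _ _ _ _ _ _ _ _ Cf yP).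
apply: ccvg_sum => k; apply: ccvgM; first exact: (@Ck_on_partial_ccvg _ _ _ FU _ _ _ _ _ _ _ _ _ _ Cg yP).
by apply: ccvg_coord; exact: control_ccvg.
Qed.

End closed_loop.
End coefficients.

(** * Compactness along an ultrafilter *)

Section ultrafilter_compactness.
Context {R : realType}.

Lemma le_coord_norm p q (M : 'M[R]_(p, q)) i j : `|M i j| <= `|M|.
Proof.
by rewrite [leRHS]/Num.norm/= mx_normrE; apply/bigmax_geP; right; exists (i, j).
Qed.

Lemma mx_norm_le p q (M : 'M[R]_(p, q)) C : 0 <= C ->
  (forall i j, `|M i j| <= C) -> `|M| <= C.
Proof.
move=> C0 MC; rewrite /Num.norm/= mx_normrE; by apply/bigmax_leP.
Qed.

Context {I : Type} (U : set_system I) {UU : UltraFilter U}.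

Lemma ultra_fmap {S : Type} (f : I -> S) : UltraFilter (f @ U).
Proof.
split; first exact: fmap_proper_filter.
move=> G PG UG; apply/seteqP; split => // A GA.
have [//|UnA] := in_ultra_setVsetC (f @^-1` A) UU.
have GnA : G (~` A) by apply: UG.
by have [x []] := filter_ex (filterI GA GnA).
Qed.

Lemma ultra_bounded_cvg p (c : I -> 'cV[R]_p) (C : R) :
  (\forall k \near U, `|c k| <= C) ->
  exists l : 'cV[R]_p, c @ U --> l.
Proof.
move=> cC.
have ex i : exists l : R, (fun k => c k i 0) @ U --> l.
  have := @segment_compact R (- C) C; rewrite compact_ultra.
  move=> /(_ ((fun k => c k i 0) @ U) (ultra_fmap _))[|l [_ cl]]; last by exists l.
  apply: filterS cC => k ck; rewrite /= in_itv/= -ler_norml.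
  exact: le_trans (le_coord_norm _ _ _) ck.
have [l cl] := choice ex.
exists (\col_i l i); apply: cvg_matrix => i j.
by rewrite mxE ord1.
Qed.

(** Arzela-Ascoli without subsequences: the pointwise limits exist by
boundedness, and the Lipschitz bound makes the convergence uniform. *)
Lemma ultra_ascoli p (a b : R) (y : I -> R -> 'cV[R]_p) (C L : R) :
  (\forall k \near U, forall t, t \in `[a, b] -> `|y k t| <= C) ->
  (\forall k \near U, forall s t, s \in `[a, b] -> t \in `[a, b] ->
     `|y k s - y k t| <= L * `|s - t|) ->
  exists ystar, ccvg a b U y ystar.
Proof.
move=> yC yL.
have ex t : exists l : 'cV[R]_p, t \in `[a, b] -> (fun k => y k t) @ U --> l.
  have [tab|_] := boolP (t \in `[a, b]); last by exists 0.
  have [|l yl] := @ultra_bounded_cvg _ (fun k => y k t) C.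
    by apply: filterS yC => k; exact.
  by exists l.
have [ystar ys] := choice ex.
by exists ystar; exact: ccvg_equilipschitz yL.
Qed.

End ultrafilter_compactness.

(** * Weak derivatives: limits and a priori bounds *)

Section trajectories.
Context {R : realType}.
Notation mu := (@lebesgue_measure R).

Lemma intble_continuousM (a b : R) (h phi : R -> R) : continuous phi ->
  mu.-integrable `]a, b[ (EFin \o h) ->
  mu.-integrable `]a, b[ (EFin \o (fun t => h t * phi t)).
Proof.
move=> cphi hi; apply: (@eq_intble _ _ _ (fun t => phi t * h t)).
  by move=> t _; rewrite mulrC.
by apply: intbleM => //; exact: continuous_subspaceT.
Qed.

Lemma weak_primitiveB (a b : R) (w1 w2 v1 v2 : R -> R) :
  mu.-integrable `]a, b[ (EFin \o w1) -> mu.-integrable `]a, b[ (EFin \o w2) ->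
  mu.-integrable `]a, b[ (EFin \o v1) -> mu.-integrable `]a, b[ (EFin \o v2) ->
  weak_primitive a b w1 v1 -> weak_primitive a b w2 v2 ->
  weak_primitive a b (fun t => w1 t - w2 t) (fun t => v1 t - v2 t).
Proof.
move=> w1i w2i v1i v2i h1 h2 phi tphi.
have [cphi cphi'] := test_function_continuous tphi.
under eq_Rintegral do rewrite mulrBl.
rewrite RintegralB//; [|exact: intble_continuousM..].
under [in RHS]eq_Rintegral do rewrite mulrBl.
rewrite RintegralB//; [|exact: intble_continuousM..].
by rewrite h1// h2// opprB opprK addrC.
Qed.

(** Test functions and their derivatives are bounded, so L^1 convergence suffices
to pass to the limit in the weak formulation. *)
Lemma weak_primitive_limit {I : Type} (U : set_system I) {FU : ProperFilter U}
    (a b : R) (w v : I -> R -> R) (ws vs : R -> R) :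
  L1cvg a b U w ws -> L1cvg a b U v vs ->
  (forall k, weak_primitive a b (w k) (v k)) -> weak_primitive a b ws vs.
Proof.
move=> wws vvs wv phi tphi.
have [cphi cphi'] := test_function_continuous tphi.
have lim (f : I -> R -> R) fs g : continuous g -> L1cvg a b U f fs ->
    (fun k => \int[mu]_(t in `]a, b[) (f k t * g t)) @ U -->
    \int[mu]_(t in `]a, b[) (fs t * g t).
  move=> cg ffs; apply: L1cvg_integral.
  apply: (L1cvg_ext (u := fun k t => g t * f k t) (v := fun t => g t * fs t)).
  - by move=> *; rewrite mulrC.
  - by move=> *; rewrite mulrC.
  - by apply: L1cvg_cont_mul => //; exact: continuous_subspaceT.
have h1 := lim _ _ _ cphi' wws.
have h2 := cvgN (lim _ _ _ cphi vvs).
have e : (fun k => \int[mu]_(t in `]a, b[) (w k t * (phi^`())%classic t)) =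
    - (fun k => \int[mu]_(t in `]a, b[) (v k t * phi t)).
  by apply/funext => k; rewrite wv.
rewrite e in h1.
exact: (norm_cvg_unique h1 (h2 _)).
Qed.

Lemma within_coord n (A : set R) (z : R -> 'cV[R]_n) i :
  {within A, continuous z} -> {within A, continuous (fun t => z t i 0)}.
Proof.
move=> cz x; apply: (@continuous_comp (subspace A) _ _ z
  (fun M : 'cV[R]_n => M i 0)); first exact: cz.
exact: coord_continuous.
Qed.

Lemma weak_derivE n (a b : R) (y v : R -> 'cV[R]_n) :
  weak_deriv a b y v <->
  L2 a b v /\ forall i, weak_primitive a b (fun t => y t i 0) (fun t => v t i 0).
Proof.
split=> [[? h]|[? h]]; split => //.
  by move=> i phi tphi; exact: h.
by move=> phi tphi i; exact: h.
Qed.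

Lemma bounded_field_lipschitz n (a b : R) (y v : R -> 'cV[R]_n) (C : R) :
  a < b -> 0 <= C ->
  {within `[a, b], continuous y} -> {within `[a, b], continuous v} ->
  (forall i, weak_primitive a b (fun t => y t i 0) (fun t => v t i 0)) ->
  (forall t, t \in `]a, b[ -> `|v t| <= C) ->
  forall s t, s \in `[a, b] -> t \in `[a, b] -> `|y s - y t| <= C * `|s - t|.
Proof.
move=> ab C0 cy cv yv vC s t sab tab.
apply: mx_norm_le => [|i j]; first by rewrite mulr_ge0.
rewrite ord1 !mxE.
apply: (@bounded_derive_lipschitz _ a b (fun t => y t i 0) (fun t => v t i 0)) => //.
- exact: within_coord.
- by apply: weak_deriv_continuous; [exact: ab|exact: within_coord..|exact: yv].
- by move=> x xab; apply: le_trans (le_coord_norm _ _ _) _; exact: vC.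
Qed.

Lemma Linfty_bounded n (a b : R) (y : R -> 'cV[R]_n) (M : R) : a < b ->
  {within `[a, b], continuous y} -> (Linfty_norm a b y <= M%:E)%E ->
  0 <= M -> forall t, t \in `[a, b] -> `|y t| <= M.
Proof.
move=> ab cy /ess_supP yM M0 t tab; apply: mx_norm_le => // i j; rewrite ord1.
apply: (@ae_le_within _ a b ab (fun t => `|y t i 0|)) => //.
  have cyi := within_coord (i := i) cy.
  move=> x; apply: (@continuous_comp (subspace `[a, b]) _ _
    (fun t => y t i 0) (fun r : R => `|r|)); first exact: cyi.
  exact: norm_continuous.
move: yM; apply: filterS => x; rewrite patchE => + xab.
rewrite mem_set// lee_fin; apply: le_trans.
rewrite -[leLHS]sqrtr_sqr /fnorm ler_wsqrtr// (bigD1 i)//= big_ord1 lerDl.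
by apply: sumr_ge0 => k _; apply: sumr_ge0 => l _; exact: sqr_ge0.
Qed.

End trajectories.

(** * Compactness of states and of solutions of linear equations *)

Section compactness_of_closed_loops.
Context {R : realType}.
Notation mu := (@lebesgue_measure R).

Section linear_equation.
Context {I : Type} (U : set_system I) {UU : UltraFilter U} (a b : R) (n : nat).

(** Coefficients that converge uniformly are eventually bounded; Gronwall then
bounds the solutions, the equation bounds their derivatives, and Ascoli
applies. *)
Lemma linear_backward_compactness (A : I -> R -> 'M[R]_n) As
    (d w : I -> R -> 'cV[R]_n) ds (B : R) : a < b ->
  ccvg a b U A As -> ccvg a b U d ds ->
  (forall k, {within `[a, b], continuous (A k)}) ->
  (forall k, {within `[a, b], continuous (d k)}) ->
  (forall k, {within `[a, b], continuous (w k)}) ->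
  (forall k i, weak_primitive a b (fun t => w k t i 0)
     (fun t => (- (A k t *m w k t + d k t)) i 0)) ->
  (\forall k \near U, `|w k b| <= B) ->
  exists ws, ccvg a b U w ws.
Proof.
move=> ab AAs dds cA cd cw wv wB.
have [CA [CA0 UA]] := ccvg_bounded AAs.
have [Cd [Cd0 Ud]] := ccvg_bounded dds.
pose C := CA + Cd; have C0 : 0 < C by rewrite addr_gt0.
pose v k t := - (A k t *m w k t + d k t).
have cv k : {within `[a, b], continuous (v k)}.
  have h : ccvg a b U (fun=> v k) (v k).
    apply: ccvgN; apply: ccvgD; last exact: ccvg_const.
    by apply: ccvg_mulmx; exact: ccvg_const.
  exact: ccvg_continuous h.
pose M := (n%:R * B ^+ 2 + 1) * expR (C * (3 * n%:R + 1) * (b - a)).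
have vle k i x : (forall t, t \in `[a, b] -> `|A k t| <= CA) ->
    (forall t, t \in `[a, b] -> `|d k t| <= Cd) -> x \in `[a, b] ->
    `|v k x i 0| <= C * (1 + \sum_j `|w k x j 0|).
  move=> Ak dk xab; rewrite !mxE normrN (le_trans (ler_normD _ _))//.
  rewrite mulrDr mulr1 addrC lerD//.
    rewrite (le_trans (le_coord_norm _ _ _))// (le_trans (dk _ xab))//.
    by rewrite lerDr ltW.
  rewrite (le_trans (ler_norm_sum _ _ _))// mulr_sumr ler_sum// => j _.
  rewrite normrM ler_wpM2r// (le_trans (le_coord_norm _ _ _))//.
  by rewrite (le_trans (Ak _ xab))// lerDl ltW.
have wM : \forall k \near U, forall t, t \in `[a, b] -> `|w k t| <= M.
  near=> k => t tab.
  have Ak : forall t, t \in `[a, b] -> `|A k t| <= CA by near: k.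
  have dk : forall t, t \in `[a, b] -> `|d k t| <= Cd by near: k.
  have wk : `|w k b| <= B by near: k.
  have B0 : 0 <= B by exact: le_trans wk.
  have M0 : 0 <= M.
    by rewrite mulr_ge0 ?expR_ge0// addr_ge0// mulr_ge0// sqr_ge0.
  have := @gronwall_backward R a b n (fun i t => w k t i 0)
    (fun i t => v k t i 0) C (ltW C0) _ _ _ t tab.
  move=> /(_ (fun i => within_coord (i := i) (cw k))) h.
  have {}h := h (fun i => weak_deriv_continuous ab (within_coord (cw k))
    (within_coord (cv k)) (wv k i)).
  have {}h := h (fun i x xab => vle k i x Ak dk (subset_itv_oo_cc xab)).
  have {}h : \sum_i w k t i 0 ^+ 2 + 1 <= M.
    apply: le_trans h _; apply: ler_pM.
    - by rewrite addr_ge0// sumr_ge0// => i _; exact: sqr_ge0.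
    - exact: expR_ge0.
    - rewrite lerD2r mulr_natl -[n in X in _ <= X]card_ord -sumr_const.
      apply: ler_sum => i _; rewrite -real_normK ?num_real//.
      by rewrite ler_pXn2r ?nnegrE// (le_trans (le_coord_norm _ _ _)).
    - rewrite ler_expR ler_wpM2l//; first by rewrite mulr_ge0 ?ltW// ltr_wpDl.
      by rewrite lerD2l lerN2 (itvP tab).
  apply: mx_norm_le => // i j; rewrite ord1; apply: le_trans h.
  rewrite (bigD1 i)//= -real_normK ?num_real//.
  have S0 : 0 <= \sum_(j < n | j != i) w k t j 0 ^+ 2.
    by apply: sumr_ge0 => l _; exact: sqr_ge0.
  by have := sqr_ge0 (`|w k t i 0| - 2^-1); move: S0; set S := \sum_(_ < n | _) _; nra.
have wL : \forall k \near U, forall s t, s \in `[a, b] -> t \in `[a, b] ->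
    `|w k s - w k t| <= C * (1 + n%:R * `|M|) * `|s - t|.
  near=> k.
  have Ak : forall t, t \in `[a, b] -> `|A k t| <= CA by near: k.
  have dk : forall t, t \in `[a, b] -> `|d k t| <= Cd by near: k.
  have wk : forall t, t \in `[a, b] -> `|w k t| <= M by near: k.
  have L0 : 0 <= C * (1 + n%:R * `|M|).
    by rewrite mulr_ge0 ?(ltW C0)// addr_ge0// mulr_ge0.
  apply: (@bounded_field_lipschitz _ _ _ _ _ (v k)) => // t tab.
  have tab' := subset_itv_oo_cc tab.
  apply: mx_norm_le => // i j; rewrite ord1; apply: le_trans (vle _ _ _ Ak dk tab') _.
  rewrite ler_wpM2l ?(ltW C0)// lerD2l mulr_natl -[n in X in _ <= X]card_ord.
  rewrite -sumr_const; apply: ler_sum => l _.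
  rewrite (le_trans (le_coord_norm _ _ _))// (le_trans (wk _ tab'))//.
  exact: ler_norm.
exact: ultra_ascoli wM wL.
Unshelve. all: by end_near. Qed.

End linear_equation.

Section closed_loop.
Context {d n m : nat} (P : control_problem R n m).
Context (W : 'cV[R]_d -> R -> 'cV[R]_n -> R) (l : nat).
Notation T := (horizon P).
Hypothesis stP : standing_assumptions P.
Hypothesis regP : regularity_dynamics P.
Hypothesis CW :
  Ck_open l.+1 [set: 'cV[R]_d * R * 'cV[R]_n] (fun x => W x.1.1 x.1.2 x.2 : R).

Context {I : Type} (U : set_system I) {UU : UltraFilter U}.
Context (theta : I -> 'cV[R]_d) (thetas : 'cV[R]_d).
Hypothesis thetaP : theta @ U --> thetas.

(** Continuity of a function is continuous convergence of the constant family. *)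
Lemma field_continuous th z : {within `[0, T], continuous z} ->
  {within `[0, T], continuous (closed_loop_field P W th z)}.
Proof.
move=> cz.
have h : ccvg 0 T U (fun=> closed_loop_field P W th z) (closed_loop_field P W th z).
  apply: (@field_ccvg _ _ _ _ P W l regP CW I U _ (fun=> th) th (fun=> z) z).
    exact: cvg_cst.
  exact: ccvg_const.
exact: ccvg_continuous h.
Qed.

Lemma adjoint_matrix_continuous th z : {within `[0, T], continuous z} ->
  {within `[0, T], continuous (adjoint_matrix P W th z)}.
Proof.
move=> cz.
have h : ccvg 0 T U (fun=> adjoint_matrix P W th z) (adjoint_matrix P W th z).
  apply: (@adjoint_matrix_ccvg _ _ _ _ P W l regP CW I U _ (fun=> th) th (fun=> z) z).
    exact: cvg_cst.
  exact: ccvg_const.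
exact: ccvg_continuous h.
Qed.

(** Let s k be a time at which the field along y k is largest.  The field depends on
the state only through its value, so that maximum is attained along the constant
function y k (s k) too.  These constants converge along the ultrafilter, and
[field_ccvg] applied to constant functions bounds the maxima. *)
Lemma field_bounded (y : I -> R -> 'cV[R]_n) (M : R) :
  (forall k, {within `[0, T], continuous (y k)}) ->
  (forall k t, t \in `[0, T] -> `|y k t| <= M) ->
  exists C, 0 < C /\ \forall k \near U, forall t, t \in `[0, T] ->
    `|closed_loop_field P W (theta k) (y k) t| <= C.
Proof.
move=> cy yM; have T0 : 0 <= T by case: stP => /ltW.
have cF k : {within `[0, T], continuous
    (fun t => `|closed_loop_field P W (theta k) (y k) t|)}.
  have cf := @field_continuous (theta k) _ (cy k).
  move=> x; apply: (@continuous_comp (subspace `[0, T]) _ _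
    (closed_loop_field P W (theta k) (y k)) (fun z => `|z|)); first exact: cf.
  exact: norm_continuous.
have ex k : exists s, s \in `[0, T] /\ forall t, t \in `[0, T] ->
    `|closed_loop_field P W (theta k) (y k) t| <=
    `|closed_loop_field P W (theta k) (y k) s|.
  by have [s sT smax] := EVT_max T0 (cF k); exists s.
have [s sP] := choice ex.
have [|z yz] := @ultra_bounded_cvg _ _ U _ _ (fun k => y k (s k)) M.
  by near=> k; apply: yM; case: (sP k).
have h : ccvg 0 T U
    (fun k => closed_loop_field P W (theta k) (fun=> y k (s k)))
    (closed_loop_field P W thetas (fun=> z)).
  apply: (@field_ccvg _ _ _ _ P W l regP CW I U _ theta thetas
    (fun k _ => y k (s k)) (fun=> z) thetaP).
  exact: ccvg_param.
have [C [C0 UC]] := @ccvg_bounded _ _ _ _ _ _ _ _ _ h.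
exists C; split; first exact: C0.
apply: filterS UC => k kC t tT; have [sT /(_ _ tT) smax] := sP k.
exact: le_trans smax (kC _ sT).
Unshelve. all: by end_near. Qed.

Lemma state_compactness (y : I -> R -> 'cV[R]_n) (M : R) :
  (forall k, {within `[0, T], continuous (y k)}) ->
  (forall k t, t \in `[0, T] -> `|y k t| <= M) ->
  (forall k, weak_deriv 0 T (y k) (closed_loop_field P W (theta k) (y k))) ->
  exists ystar, ccvg 0 T U y ystar.
Proof.
move=> cy yM wy; have T0 : 0 < T by case: stP.
have [C [C0 UC]] := field_bounded cy yM.
apply: (@ultra_ascoli _ _ _ _ _ _ _ _ M C).
  by near=> k => t tT; exact: yM.
apply: filterS UC => k kC.
apply: (@bounded_field_lipschitz _ _ _ _ _
  (closed_loop_field P W (theta k) (y k))) => //.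
- exact: ltW.
- exact: field_continuous.
- by have /weak_derivE[] := wy k.
- by move=> t tT; apply: kC; exact: subset_itv_oo_cc.
Unshelve. all: by end_near. Qed.

End closed_loop.
End compactness_of_closed_loops.

(** * Convergence of the costs *)

Section learning_problem.
Context {R : realType}.
Notation mu := (@lebesgue_measure R).
Context {d n m : nat} (P : control_problem R n m).
Context (W : 'cV[R]_d -> R -> 'cV[R]_n -> R) (l : nat).
Notation T := (horizon P).
Hypothesis stP : standing_assumptions P.
Hypothesis regP : regularity_dynamics P.
Hypothesis CW :
  Ck_open l.+1 [set: 'cV[R]_d * R * 'cV[R]_n] (fun x => W x.1.1 x.1.2 x.2 : R).

(** The constraints of the learning problem for one initial state.  The admissible
set is the product of these constraints over the initial states. *)
Definition closed_loop_pair (y0 : 'cV[R]_n) (theta : 'cV[R]_d)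
    (y p : R -> 'cV[R]_n) : Prop :=
  let u := closed_loop_control P (W theta) y in
  [/\ H1 0 T y /\ H1 0 T p,
      weak_deriv 0 T y (dynamics P y u),
      y 0 = y0,
      weak_deriv 0 T p (fun t => - adjoint_rhs P y u p t) &
      p T = (costQ2 P)^T *m costQ2 P *m (y T - ydesT P)].

Let Q := (costQ1 P)^T *m costQ1 P.

Lemma adjoint_rhsE theta y p t :
  - adjoint_rhs P y (closed_loop_control P (W theta) y) p t =
  - (adjoint_matrix P W theta y t *m p t + Q *m y t) + Q *m ydes P t.
Proof.
rewrite /adjoint_rhs /adjoint_matrix mulmxDl -/Q mulmxBr.
by rewrite [in LHS]addrA [in LHS]opprB [in RHS]addrC.
Qed.

Lemma ydes_sqint (p : nat) (N : 'M[R]_(p, n)) i :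
  sqint 0 T (fun t => (N *m ydes P t) i 0).
Proof.
have /L2P yd : L2 0 T (ydes P) by case: stP.
rewrite (_ : (fun _ => _) = fun t => \sum_j N i j * ydes P t j 0).
  by apply: sqint_sum => j; apply: sqintZ; exact: yd.
by apply/funext => t; rewrite mxE.
Qed.

Let T0 : 0 < T. Proof. by case: stP. Qed.
Let T_in : T \in `[0, T]. Proof. by rewrite in_itv/= lexx ltW. Qed.
Let zero_in : 0 \in `[0, T]. Proof. by rewrite in_itv/= lexx ltW. Qed.

Section cost.
Context {I : Type} (U : set_system I) {FU : ProperFilter U}.
Context (theta : I -> 'cV[R]_d) (thetas : 'cV[R]_d).
Hypothesis thetaP : theta @ U --> thetas.

Lemma ccvg_mulmxr (p q : nat) (N : 'M[R]_(p, q)) (y : I -> R -> 'cV[R]_q) ys :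
  ccvg 0 T U y ys -> ccvg 0 T U (fun k t => N *m y k t) (fun t => N *m ys t).
Proof.
move=> yys; apply: (@ccvg_mulmx _ _ _ _ _ _ _ _ _ (fun _ _ => N) (fun=> N)) => //.
by apply: ccvg_param; exact: cvg_cst.
Qed.

Lemma within_mulmxr (p q : nat) (N : 'M[R]_(p, q)) (y : R -> 'cV[R]_q) :
  {within `[0, T], continuous y} ->
  {within `[0, T], continuous (fun t => N *m y t)}.
Proof.
move=> cy.
have h : ccvg 0 T U (fun _ t => N *m y t) (fun t => N *m y t).
  by apply: ccvg_mulmxr; exact: ccvg_const.
exact: ccvg_continuous h.
Qed.

Lemma control_continuous th z : {within `[0, T], continuous z} ->
  {within `[0, T], continuous (closed_loop_control P (W th) z)}.
Proof.
move=> cz.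
have h : ccvg 0 T U (fun=> closed_loop_control P (W th) z)
    (closed_loop_control P (W th) z).
  apply: (@control_ccvg _ _ _ _ P W l regP CW I U _ (fun=> th) th (fun=> z) z).
    exact: cvg_cst.
  exact: ccvg_const.
exact: ccvg_continuous h.
Qed.

Lemma within_continuousM (u v : R -> R) : {within `[0, T], continuous u} ->
  {within `[0, T], continuous v} ->
  {within `[0, T], continuous (fun t => u t * v t)}.
Proof. by move=> cu cv x; apply: continuousM; [exact: cu|exact: cv]. Qed.

Context (y : I -> R -> 'cV[R]_n) (ys : R -> 'cV[R]_n).
Hypothesis cy : forall k, {within `[0, T], continuous (y k)}.
Hypothesis yys : ccvg 0 T U y ys.

(** Expanding the square of the tracking term componentwise leaves products of a
continuously converging function with a power of a component of Q_1 y_d. *)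
Lemma cost_ccvg :
  ccvg 0 T U (fun k t => cost P t (y k) (closed_loop_control P (W (theta k)) (y k)))
    (fun t => cost P t ys (closed_loop_control P (W thetas) ys)).
Proof.
apply: ccvgD; apply: ccvgMl; last first.
  apply: ccvg_param.
  have h : ccvg 0 T U (fun k t => fnorm (costQ2 P *m (y k t - ydesT P)) ^+ 2)
      (fun t => fnorm (costQ2 P *m (ys t - ydesT P)) ^+ 2).
    apply: ccvg_fnorm2; apply: ccvg_mulmxr; apply: ccvgB => //.
    by apply: ccvg_param; exact: cvg_cst.
  exact: (ccvg_pointwise h T_in).
apply: L1cvg_tail; first exact: ltW.
pose D i t := (costQ1 P *m ydes P t) i 0.
pose H (z : R -> 'cV[R]_n) u t := \sum_i
  ((costQ1 P *m z t) i 0 * (costQ1 P *m z t) i 0 +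
   (-2 * (costQ1 P *m z t) i 0) * D i t + D i t ^+ 2) + beta P * fnorm (u t : 'cV[R]_m) ^+ 2.
have HE z u t : H z u t =
    fnorm (costQ1 P *m (z t - ydes P t)) ^+ 2 + beta P * fnorm (u t) ^+ 2.
  rewrite /H [in RHS]fnorm2E1; congr (_ + _); apply: eq_bigr => i _.
  rewrite mulmxBr [in RHS]mxE [X in (_ + X) ^+ 2]mxE -/(D i t).
  by move: (D i t) ((costQ1 P *m z t) i 0) => x a; ring.
apply: (L1cvg_ext
  (u := fun k => H (y k) (closed_loop_control P (W (theta k)) (y k)))
  (v := H ys (closed_loop_control P (W thetas) ys))); [by move=> *; exact: HE..|].
have ca k i : {within `[0, T], continuous (fun t => (costQ1 P *m y k t) i 0)}.
  by apply: within_coord; exact: within_mulmxr.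
have cca i : ccvg 0 T U (fun k t => (costQ1 P *m y k t) i 0)
    (fun t => (costQ1 P *m ys t) i 0).
  by apply: ccvg_coord; exact: ccvg_mulmxr.
apply: L1cvgD.
  apply: L1cvg_sum => i; apply: L1cvgD; first apply: L1cvgD.
  - apply: ccvg_L1cvg; last exact: ccvgM.
    by move=> k; exact: within_continuousM.
  - apply: ccvg_L1cvgM.
    + move=> k; apply: within_continuousM; last exact: ca.
      by apply: continuous_subspaceT => x; exact: cvg_cst.
    + exact: ccvgMl.
    + by apply: sqint_intble; exact: ydes_sqint.
  - by apply: L1cvg_cst; case: (ydes_sqint (costQ1 P) i).
apply: L1cvgZ; apply: ccvg_L1cvg.
  move=> k.
  have h : ccvg 0 T U
      (fun _ t => fnorm (closed_loop_control P (W (theta k)) (y k) t) ^+ 2)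
      (fun t => fnorm (closed_loop_control P (W (theta k)) (y k) t) ^+ 2).
    by apply: ccvg_fnorm2; apply: ccvg_const; exact: control_continuous.
  exact: ccvg_continuous h.
by apply: ccvg_fnorm2; exact: (control_ccvg regP CW).
Qed.

Context (p : I -> R -> 'cV[R]_n) (ps : R -> 'cV[R]_n) (g1 g2 : R).
Hypothesis cp : forall k, {within `[0, T], continuous (p k)}.
Hypothesis pps : ccvg 0 T U p ps.

Definition penalty th (z q : R -> 'cV[R]_n) t :=
  g1 / 2 * `|W th t (z t) - cost P t z (closed_loop_control P (W th) z)| ^+ 2
  + g2 / 2 * fnorm (grad (W th t) (z t) - q t) ^+ 2.

Lemma penalty_ccvg :
  ccvg 0 T U (fun k => penalty (theta k) (y k) (p k)) (penalty thetas ys ps).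
Proof.
apply: ccvgD; apply: ccvgMl.
  pose D th z t := W th t (z t) - cost P t z (closed_loop_control P (W th) z).
  have DD : ccvg 0 T U (fun k => D (theta k) (y k)) (D thetas ys).
    by apply: ccvgB; [exact: (value_ccvg CW)|exact: cost_ccvg].
  apply: (@ccvg_ext _ _ _ _ _ _ _
    (fun k t => D (theta k) (y k) t * D (theta k) (y k) t) _
    (fun t => D thetas ys t * D thetas ys t)).
  - by move=> k t _; rewrite real_normK ?num_real.
  - by move=> t _; rewrite real_normK ?num_real.
  - exact: ccvgM.
by apply: ccvg_fnorm2; apply: ccvgB => //; exact: (grad_ccvg CW).
Qed.

End cost.

Lemma learning_cost_cvg {I : Type} (U : set_system I) {FU : ProperFilter U}
    (theta : I -> 'cV[R]_d) (thetas : 'cV[R]_d)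
    (y p : I -> R -> 'cV[R]_n) (ys ps : R -> 'cV[R]_n) (g1 g2 : R) :
  theta @ U --> thetas ->
  (forall k, {within `[0, T], continuous (y k)}) ->
  (forall k, {within `[0, T], continuous (p k)}) ->
  ccvg 0 T U y ys -> ccvg 0 T U p ps ->
  (fun k => learning_cost P g1 g2 (W (theta k)) (y k) (p k)) @ U -->
  learning_cost P g1 g2 (W thetas) ys ps.
Proof.
move=> tt cy cp yys pps; apply: cvgD.
  exact: (ccvg_pointwise (cost_ccvg tt cy yys) zero_in).
apply: (@L1cvg_integral _ _ _ _ U _
  (fun k => penalty g1 g2 (theta k) (y k) (p k)) (penalty g1 g2 thetas ys ps)).
apply: ccvg_L1cvg; last exact: penalty_ccvg.
move=> k.
have h : ccvg 0 T U (fun=> penalty g1 g2 (theta k) (y k) (p k))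
    (penalty g1 g2 (theta k) (y k) (p k)).
  apply: (@penalty_ccvg I U _ (fun=> theta k) _ _ (fun=> y k) _ _ _ (fun=> p k)).
  - exact: cvg_cst.
  - by move=> _; exact: cy.
  - by apply: ccvg_const; exact: cy.
  - by apply: ccvg_const; exact: cp.
exact: ccvg_continuous h.
Qed.

End learning_problem.

(** * Passing to the limit in the constraints *)

Section closed_loop_limits.
Context {R : realType}.
Notation mu := (@lebesgue_measure R).
Context {d n m : nat} (P : control_problem R n m).
Context (W : 'cV[R]_d -> R -> 'cV[R]_n -> R) (l : nat).
Notation T := (horizon P).
Hypothesis stP : standing_assumptions P.
Hypothesis regP : regularity_dynamics P.
Hypothesis CW :
  Ck_open l.+1 [set: 'cV[R]_d * R * 'cV[R]_n] (fun x => W x.1.1 x.1.2 x.2 : R).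
Context {I : Type} (U : set_system I) {UU : UltraFilter U}.
Context (theta : I -> 'cV[R]_d) (thetas : 'cV[R]_d).
Hypothesis thetaP : theta @ U --> thetas.
Context (y0 : 'cV[R]_n) (y p : I -> R -> 'cV[R]_n).
Hypothesis yp : forall k, closed_loop_pair P W y0 (theta k) (y k) (p k).

Let Q := (costQ1 P)^T *m costQ1 P.
Let N2 := (costQ2 P)^T *m costQ2 P.
Let T0 : 0 < T. Proof. by case: stP. Qed.
Let T_in : T \in `[0, T]. Proof. by rewrite in_itv/= lexx ltW. Qed.
Let zero_in : 0 \in `[0, T]. Proof. by rewrite in_itv/= lexx ltW. Qed.

Let cy k : {within `[0, T], continuous (y k)}.
Proof. by case: (yp k) => -[[]]. Qed.

Let cp k : {within `[0, T], continuous (p k)}.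
Proof. by case: (yp k) => -[_ []]. Qed.

Let cF th (z : R -> 'cV[R]_n) : {within `[0, T], continuous z} ->
  {within `[0, T], continuous (closed_loop_field P W th z)}.
Proof. exact: (field_continuous regP CW (U := U)). Qed.

Let cA th (z : R -> 'cV[R]_n) : {within `[0, T], continuous z} ->
  {within `[0, T], continuous (adjoint_matrix P W th z)}.
Proof. exact: (adjoint_matrix_continuous regP CW (U := U)). Qed.

Let cQ (N : 'M[R]_n) (z : R -> 'cV[R]_n) : {within `[0, T], continuous z} ->
  {within `[0, T], continuous (fun t => N *m z t)}.
Proof. exact: (within_mulmxr (U := U)). Qed.

(** The fixed square integrable part e of the right-hand sides is the contribution
of y_d; for the state equation it is zero. *)
Lemma weak_deriv_limit (w v : I -> R -> 'cV[R]_n) (e ws vs : R -> 'cV[R]_n) :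
  (forall k, {within `[0, T], continuous (w k)}) ->
  (forall k, {within `[0, T], continuous (v k)}) ->
  (forall i, sqint 0 T (fun t => e t i 0)) ->
  ccvg 0 T U w ws -> ccvg 0 T U v vs ->
  (forall k, weak_deriv 0 T (w k) (fun t => v k t + e t)) ->
  weak_deriv 0 T ws (fun t => vs t + e t).
Proof.
move=> cw cv ei wws vvs wv; apply/weak_derivE.
have cvs : {within `[0, T], continuous vs} by exact: ccvg_continuous vvs.
split.
  apply/L2P => i; rewrite (_ : (fun _ => _) = fun t => vs t i 0 + e t i 0).
    by apply: sqintD => //; apply: within_sqint; exact: within_coord.
  by apply/funext => t; rewrite mxE.
move=> i; apply: (weak_primitive_limit (U := U) (w := fun k t => w k t i 0)
    (v := fun k t => (v k t + e t) i 0)).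
- apply: ccvg_L1cvg; first by move=> k; exact: within_coord.
  exact: ccvg_coord.
- apply: (L1cvg_ext (u := fun k t => v k t i 0 + e t i 0)
      (v := fun t => vs t i 0 + e t i 0)).
  + by move=> k t _; rewrite [in RHS]mxE.
  + by move=> t _; rewrite [in RHS]mxE.
  + apply: L1cvgD; last by apply: L1cvg_cst; exact: sqint_intble.
    apply: ccvg_L1cvg; last exact: ccvg_coord.
    by move=> k; exact: within_coord.
- by move=> k; have /weak_derivE[_] := wv k; exact.
Qed.

Section limit.
Context (ys ps : R -> 'cV[R]_n).
Hypotheses (yys : ccvg 0 T U y ys) (pps : ccvg 0 T U p ps).

Lemma closed_loop_pair_limit : closed_loop_pair P W y0 thetas ys ps.
Proof.
have cys : {within `[0, T], continuous ys} by exact: ccvg_continuous yys.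
have cps : {within `[0, T], continuous ps} by exact: ccvg_continuous pps.
have cont_L2 z : {within `[0, T], continuous z} -> L2 0 T z.
  by move=> cz; apply/L2P => i; apply: within_sqint; exact: within_coord.
have addr0E (f : R -> 'cV[R]_n) : (fun t => f t + (fun=> 0) t) = f.
  by apply/funext => t; rewrite addr0.
have wys : weak_deriv 0 T ys (closed_loop_field P W thetas ys).
  rewrite -[X in weak_deriv _ _ _ X]addr0E.
  apply: (@weak_deriv_limit y (fun k => closed_loop_field P W (theta k) (y k))).
  - exact: cy.
  - by move=> k; exact: cF.
  - move=> i; rewrite (_ : (fun _ => _) = cst 0); last first.
      by apply/funext => t; rewrite mxE.
    by apply: within_sqint; apply: continuous_subspaceT => x; exact: cvg_cst.
  - exact: yys.
  - exact: (field_ccvg regP CW).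
  - by move=> k; rewrite addr0E; case: (yp k).
have wps : weak_deriv 0 T ps (fun t =>
    - adjoint_rhs P ys (closed_loop_control P (W thetas) ys) ps t).
  pose G th (z q : R -> 'cV[R]_n) t :=
    - (adjoint_matrix P W th z t *m q t + Q *m z t).
  have GE th z q : (fun t => - adjoint_rhs P z (closed_loop_control P (W th) z) q t)
      = fun t => G th z q t + Q *m ydes P t.
    by apply/funext => t; exact: adjoint_rhsE.
  rewrite GE; apply: (@weak_deriv_limit p (fun k => G (theta k) (y k) (p k))).
  - exact: cp.
  - move=> k; have h : ccvg 0 T U (fun=> G (theta k) (y k) (p k))
        (G (theta k) (y k) (p k)).
      apply: ccvgN; apply: ccvgD; last by apply: ccvg_const; exact: cQ.
      by apply: ccvg_mulmx; apply: ccvg_const; [exact: cA|exact: cp].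
    exact: ccvg_continuous h.
  - by move=> i; exact: ydes_sqint.
  - exact: pps.
  - apply: ccvgN; apply: ccvgD; last exact: ccvg_mulmxr.
    by apply: ccvg_mulmx; [exact: (adjoint_matrix_ccvg regP CW)|exact: pps].
  - by move=> k; rewrite -GE; case: (yp k).
split.
- split; split.
  + exact: cont_L2.
  + by exists (closed_loop_field P W thetas ys).
  + exact: cys.
  + exact: cont_L2.
  + by eexists; exact: wps.
  + exact: cps.
- exact: wys.
- have h : (fun k => y k 0) @ U --> ys 0 by exact: ccvg_pointwise zero_in.
  have e : (fun k => y k 0) = fun=> y0 by apply/funext => k; case: (yp k).
  by rewrite e in h; apply: (norm_cvg_unique h); exact: cvg_cst.
- exact: wps.
- have h : (fun k => p k T) @ U --> ps T by exact: ccvg_pointwise T_in.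
  have e : (fun k => p k T) = fun k => N2 *m (y k T - ydesT P).
    by apply/funext => k; case: (yp k).
  rewrite e in h; apply: (norm_cvg_unique h).
  have h2 : ccvg 0 T U (fun k t => N2 *m (y k t - ydesT P))
      (fun t => N2 *m (ys t - ydesT P)).
    apply: ccvg_mulmxr; apply: ccvgB; first exact: yys.
    by apply: ccvg_param; exact: cvg_cst.
  exact: (ccvg_pointwise h2 T_in).
Qed.

End limit.

(** The inhomogeneity h cancels: the difference of two solutions of affine
equations with the same inhomogeneity solves a linear equation whose source
consists of differences of the coefficients and of the states. *)
Lemma affine_difference (B B0 N : 'M[R]_n) (q q0 z z0 h : 'cV[R]_n) i :
  (- (B *m q + N *m z) + h) i 0 - (- (B0 *m q0 + N *m z0) + h) i 0 =
  (- (B *m (q - q0) + ((B - B0) *m q0 + N *m (z - z0)))) i 0.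
Proof.
rewrite mulmxBr mulmxBl mulmxBr.
move: (B *m q) (B *m q0) (B0 *m q0) (N *m z) (N *m z0) => a1 a2 a3 a4 a5.
by rewrite !mxE; ring.
Qed.

(** A reference costate p k0 is subtracted so that y_d disappears from the equation;
what remains has continuous coefficients. *)
Lemma adjoint_compactness (k0 : I) (ys : R -> 'cV[R]_n) :
  ccvg 0 T U y ys -> exists ps, ccvg 0 T U p ps.
Proof.
move=> yys.
pose A k := adjoint_matrix P W (theta k) (y k).
have AA : ccvg 0 T U A (adjoint_matrix P W thetas ys).
  exact: (adjoint_matrix_ccvg regP CW).
pose e k t := (A k t - A k0 t) *m p k0 t + Q *m (y k t - y k0 t).
have ee : ccvg 0 T U e (fun t =>
    (adjoint_matrix P W thetas ys t - A k0 t) *m p k0 t + Q *m (ys t - y k0 t)).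
  apply: ccvgD.
    apply: ccvg_mulmx; last by apply: ccvg_const; exact: cp.
    by apply: ccvgB; [exact: AA|apply: ccvg_const; exact: cA].
  by apply: ccvg_mulmxr; apply: ccvgB; [exact: yys|apply: ccvg_const; exact: cy].
have ce k : {within `[0, T], continuous (e k)}.
  have h : ccvg 0 T U (fun=> e k) (e k).
    apply: ccvgD.
      apply: ccvg_mulmx; last by apply: ccvg_const; exact: cp.
      by apply: ccvgB; apply: ccvg_const; exact: cA.
    by apply: ccvg_mulmxr; apply: ccvgB; apply: ccvg_const; exact: cy.
  exact: ccvg_continuous h.
have cw k : {within `[0, T], continuous (fun t => p k t - p k0 t)}.
  have h : ccvg 0 T U (fun _ t => p k t - p k0 t) (fun t => p k t - p k0 t).
    by apply: ccvgB; apply: ccvg_const; exact: cp.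
  exact: ccvg_continuous h.
have [C [C0 UC]] : exists C, 0 < C /\ \forall k \near U, forall t,
    t \in `[0, T] -> `|N2 *m (y k t - ydesT P) - p k0 T| <= C.
  have h : ccvg 0 T U (fun k t => N2 *m (y k t - ydesT P) - p k0 T)
      (fun t => N2 *m (ys t - ydesT P) - p k0 T).
    apply: ccvgB; last by apply: ccvg_param; exact: cvg_cst.
    apply: ccvg_mulmxr; apply: ccvgB; first exact: yys.
    by apply: ccvg_param; exact: cvg_cst.
  exact: ccvg_bounded h.
have [ws wws] : exists ws, ccvg 0 T U (fun k t => p k t - p k0 t) ws.
  apply: (linear_backward_compactness (B := C) T0 AA ee).
  - by move=> k; exact: cA.
  - exact: ce.
  - exact: cw.
  - move=> k i.
    pose b k t := - adjoint_rhs P (y k) (closed_loop_control P (W (theta k)) (y k))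
      (p k) t.
    have wb j : (forall i, weak_primitive 0 T (fun t => p j t i 0)
        (fun t => b j t i 0)) /\ forall i, mu.-integrable `]0, T[
        (EFin \o (fun t => b j t i 0)).
      have [_ _ _ /weak_derivE[/L2P bj h] _] := yp j; split => // i'.
      exact: sqint_intble.
    have pi j : mu.-integrable `]0, T[ (EFin \o (fun t => p j t i 0)).
      by apply: within_intble; apply: within_coord; exact: cp.
    have [wk bk] := wb k; have [wk0 bk0] := wb k0.
    have := weak_primitiveB (pi k) (pi k0) (bk i) (bk0 i) (wk i) (wk0 i).
    rewrite (_ : (fun t => p k t i 0 - p k0 t i 0) =
      fun t => (p k t - p k0 t) i 0); last by apply/funext => t; rewrite !mxE.
    rewrite (_ : (fun t => b k t i 0 - b k0 t i 0) =
      fun t => (- (A k t *m (p k t - p k0 t) + e k t)) i 0)//.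
    apply/funext => t; rewrite /b !adjoint_rhsE.
    exact: (affine_difference (A k t)).
  - apply: filterS UC => k kC; have [_ _ _ _ ->] := yp k.
    exact: kC.
exists (fun t => ws t + p k0 t).
apply: (@ccvg_ext _ _ _ _ _ _ _ (fun k t => (p k t - p k0 t) + p k0 t) _
  (fun t => ws t + p k0 t)).
- by move=> k t _; rewrite subrK.
- by [].
- by apply: ccvgD; [exact: wws|apply: ccvg_const; exact: cp].
Qed.

Lemma closed_loop_compactness (k0 : I) (M : R) :
  (forall k t, t \in `[0, T] -> `|y k t| <= M) ->
  exists ys ps, ccvg 0 T U y ys /\ ccvg 0 T U p ps.
Proof.
move=> yM.
have [|ys yys] := state_compactness stP regP CW thetaP cy yM.
  by move=> k; case: (yp k).
by have [ps pps] := adjoint_compactness k0 yys; exists ys, ps.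
Qed.

End closed_loop_limits.

(** * Coercivity of inner products *)

Section inner_products.
Context {R : realType} (d : nat) (dot : 'cV[R]_d -> 'cV[R]_d -> R).
Hypothesis dotP : inner_product dot.

Let dotC x y : dot x y = dot y x. Proof. by case: dotP. Qed.
Let dotDl a x y z : dot (a *: x + y) z = a * dot x z + dot y z.
Proof. by case: dotP. Qed.

Let dot0 z : dot 0 z = 0.
Proof. by have := dotDl (- 1) 0 0 z; rewrite scaler0 addr0 mulN1r addNr. Qed.

Let dotZ a x z : dot (a *: x) z = a * dot x z.
Proof. by rewrite -[a *: x]addr0 dotDl dot0 addr0. Qed.

Lemma inner_product_ge0 x : 0 <= dot x x.
Proof.
have [->|x0] := eqVneq x 0; first by rewrite dot0.
by apply: ltW; case: dotP => _ _; exact.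
Qed.

Let gram : 'M[R]_d := \matrix_(i, j) dot (delta_mx i 0) (delta_mx j 0).

Let dot_suml (c : 'I_d -> R) (f : 'I_d -> 'cV[R]_d) z :
  dot (\sum_i c i *: f i) z = \sum_i c i * dot (f i) z.
Proof.
have dotD u v : dot (u + v) z = dot u z + dot v z.
  by rewrite -{1}(scale1r u) dotDl mul1r.
rewrite (big_morph (dot^~ z) dotD (dot0 z)).
by apply: eq_bigr => i _; exact: dotZ.
Qed.

Let col_sumE (x : 'cV[R]_d) : x = \sum_i x i 0 *: delta_mx i 0.
Proof. by rewrite [LHS]matrix_sum_delta; apply: eq_bigr => i _; rewrite big_ord1. Qed.

Lemma inner_productE x y : dot x y = (x^T *m gram *m y) 0 0.
Proof.
rewrite [in LHS](col_sumE x) dot_suml mxE.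
under eq_bigr => i _ do rewrite dotC [in dot _](col_sumE y) dot_suml mulr_sumr.
rewrite exchange_big/=; apply: eq_bigr => j _; rewrite mxE mulr_suml.
by apply: eq_bigr => i _; rewrite !mxE dotC; ring.
Qed.

(** The Gram matrix is invertible, and the columns e i of its inverse form the dual
basis: x i 0 = dot x (e i), whose absolute value is at most
dot x x + dot (e i) (e i) because dot is nonnegative at x + e i and x - e i. *)
Lemma inner_product_coercive : exists C, forall x, `|x| <= C + dot x x.
Proof.
have gU : gram \in unitmx.
  rewrite unitmxE unitfE; apply/det0P => -[v v0 vg].
  have : dot v^T v^T = 0 by rewrite inner_productE trmxK vg mul0mx mxE.
  apply/eqP; rewrite gt_eqF//; case: dotP => _ _; apply.
  by rewrite -trmx0 (inj_eq trmx_inj).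
pose e i : 'cV[R]_d := col i (invmx gram).
have xe (x : 'cV[R]_d) i : x i 0 = dot x (e i).
  rewrite inner_productE /e colE mulmxA mulmxK// -colE.
  by rewrite !mxE.
have amgm (x z : 'cV[R]_d) : `|dot x z| <= dot x x + dot z z.
  have h1 := inner_product_ge0 (1 *: x + z).
  have h2 := inner_product_ge0 (-1 *: x + z).
  move: h1 h2; rewrite !dotDl ![dot _ (_ *: x + z)]dotC !dotDl (dotC z x).
  have := inner_product_ge0 x; have := inner_product_ge0 z.
  by rewrite ler_norml; move=> *; apply/andP; split; lra.
exists (\sum_i dot (e i) (e i)) => x.
have S0 : 0 <= \sum_i dot (e i) (e i).
  by apply: sumr_ge0 => i _; exact: inner_product_ge0.
apply: mx_norm_le => [|i j]; first by rewrite addr_ge0// inner_product_ge0.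
rewrite ord1 xe; apply: le_trans (amgm _ _) _; rewrite addrC lerD2r.
rewrite (bigD1 i)//= lerDl; apply: sumr_ge0 => k _; exact: inner_product_ge0.
Qed.

Lemma inner_product_cvg {I : Type} (U : set_system I) {FU : Filter U}
    (x : I -> 'cV[R]_d) xs :
  x @ U --> xs -> (fun k => dot (x k) (x k)) @ U --> dot xs xs.
Proof.
move=> xxs.
have E z : dot z z = \sum_j (\sum_i z i 0 * gram i j) * z j 0.
  rewrite inner_productE mxE; apply: eq_bigr => j _; rewrite mxE.
  by congr (_ * _); apply: eq_bigr => i _; rewrite mxE.
have c i : (fun k => x k i 0) @ U --> xs i 0.
  apply: (@cvg_comp _ _ _ x (fun z : 'cV[R]_d => z i 0) U (nbhs xs)) => //.
  exact: coord_continuous.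
rewrite E (_ : (fun _ => _) =
  fun k => \sum_j (\sum_i x k i 0 * gram i j) * x k j 0); last first.
  by apply/funext => k; rewrite E.
apply: (cvg_big (op := +%R)) => [|j _]; first exact: add_continuous.
apply: cvgM; last exact: c.
apply: (cvg_big (op := +%R)) => [|i _]; first exact: add_continuous.
by apply: cvgM; [exact: c|exact: cvg_cst].
Qed.

End inner_products.

(** * Existence of a minimizer *)

Section nonnegativity.
Context {R : realType} {n m : nat} (P : control_problem R n m).
Hypothesis stP : standing_assumptions P.

Lemma cost_ge0 t y u : 0 <= cost P t y u.
Proof.
have b0 : 0 <= beta P by case: stP => _ _ _ /ltW.
apply: addr_ge0; apply: mulr_ge0; rewrite ?invr_ge0 ?ler0n ?sqr_ge0//.
apply: Rintegral_ge0 => s _; apply: addr_ge0; first exact: sqr_ge0.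
by apply: mulr_ge0 => //; exact: sqr_ge0.
Qed.

Lemma learning_cost_ge0 g1 g2 W y p : 0 <= g1 -> 0 <= g2 ->
  0 <= learning_cost P g1 g2 W y p.
Proof.
move=> g10 g20; apply: addr_ge0; first exact: cost_ge0.
by apply: Rintegral_ge0 => s _; apply: addr_ge0; apply: mulr_ge0;
  rewrite ?divr_ge0 ?sqr_ge0.
Qed.

End nonnegativity.

Theorem proposition18 (R : realType) (n m : nat) (P : control_problem R n m)
    (Y0 : set 'cV[R]_n) (MY : R) (V : R -> 'cV[R]_n -> R)
    (eps0 : R) (A : approx_family R n)
    (N : nat) (L : learning_data R n N) (eps : R)
    (hP : standing_assumptions P)
    (hY0 : compact Y0)
    (hreg : regularity_assumption P Y0 MY V)
    (happ : approximation_assumption P MY V eps0 A)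
    (hL : learning_assumptions Y0 L)
    (heps : 0 < eps <= eps0)
    (hne : exists y p (theta : 'cV[R]_(pdim A eps)),
             learning_admissible P L y p theta)
    (y p : nat -> 'I_N -> R -> 'cV[R]_n) (theta : nat -> 'cV[R]_(pdim A eps))
    (hinf : infimizing_sequence P L y p theta)
    (Minf : R) (hMinf : 0 < Minf)
    (hbound : forall k i,
       (Linfty_norm 0 (horizon P) (y k i) <= Minf%:E)%E) :
  exists ystar pstar (thetastar : 'cV[R]_(pdim A eps)),
    learning_minimizer P L ystar pstar thetastar.
Proof.
have T0 : 0 < horizon P by case: hP.
have [regP _ _] := hreg.
have [eps_gt0 le_eps] := andP heps.
have [dotP CW _] : [/\ inner_product (@pdot _ _ A eps),
    Ck_open 4 [set: 'cV[R]_(pdim A eps) * R * 'cV[R]_n]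
      (fun x => Vapp x.1.1 x.1.2 x.2 : R) &
    forall (theta : 'cV[R]_(pdim A eps)) (y : 'cV[R]_n),
      Vapp theta (horizon P) y = 2^-1 * fnorm (costQ2 P *m (y - ydesT P)) ^+ 2].
  by case: happ => _ /(_ _ eps_gt0 le_eps).
have [_ w0 g10 g20 ge0] := hL.
have [adm obj_inf] := hinf.
have sum0 (z q : 'I_N -> R -> 'cV[R]_n) (eta : 'cV[R]_(pdim A eps)) :
    0 <= \sum_(i < N) weight L i *
     learning_cost P (gamma1 L) (gamma2 L) (Vapp eta) (z i) (q i).
  apply: sumr_ge0 => i _; rewrite mulr_ge0 ?(ltW (w0 i))//.
  exact: learning_cost_ge0.
have obj0 (z q : 'I_N -> R -> 'cV[R]_n) (eta : 'cV[R]_(pdim A eps)) :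
    0 <= learning_objective P L z q eta.
  rewrite addr_ge0// mulr_ge0 ?inner_product_ge0// divr_ge0//.
  exact: ltW.
have [U [UU ooU]] := ultraFilterLemma eventually_filter.
have objU : (fun k => learning_objective P L (y k) (p k) (theta k)) @ U -->
    learning_infimum P A L eps.
  by move=> S /obj_inf; exact: ooU.
have [C thetaC] := inner_product_coercive dotP.
have [thetas thetaP] : exists thetas : 'cV[R]_(pdim A eps), theta @ U --> thetas.
  pose B := (learning_infimum P A L eps + 1) / (gammaeps L / 2).
  apply: (@ultra_bounded_cvg _ _ U _ _ theta (C + B)).
  have : \forall k \near U, learning_objective P L (y k) (p k) (theta k) <=
      learning_infimum P A L eps + 1.
    by apply: (cvgr_le _ objU); rewrite ltrDl.
  apply: filterS => k kB.
  apply: le_trans (thetaC _) _; rewrite lerD2l ler_pdivlMr ?divr_gt0//.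
  by rewrite mulrC (le_trans _ kB)// lerDr.
have cont k i : {within `[0, horizon P], continuous (y k i)} /\
    {within `[0, horizon P], continuous (p k i)}.
  by have [[[_ _ cy] [_ _ cp]] _ _ _ _] := adm k i.
have yM k i t : t \in `[0, horizon P] -> `|y k i t| <= Minf.
  by move=> tT; apply: (Linfty_bounded T0 _ (hbound k i)) => //;
    [case: (cont k i)|exact: ltW].
have lim i : exists yp : (R -> 'cV[R]_n) * (R -> 'cV[R]_n),
    ccvg 0 (horizon P) U (fun k => y k i) yp.1 /\
    ccvg 0 (horizon P) U (fun k => p k i) yp.2.
  have [ys [ps h]] := @closed_loop_compactness _ _ _ _ P (@Vapp _ _ A eps) _
    hP regP CW _ U UU theta thetas thetaP (init L i) (fun k => y k i)
    (fun k => p k i) (fun k => adm k i) 0%N Minf (fun k t => @yM k i t).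
  by exists (ys, ps).
have [yps ypsP] := choice lim.
pose ys i := (yps i).1; pose ps i := (yps i).2.
have adms : learning_admissible P L ys ps thetas.
  move=> i; have [yys pps] := ypsP i.
  exact: (closed_loop_pair_limit hP regP CW thetaP (fun k => adm k i) yys pps).
exists ys, ps, thetas; split => //.
have objs : (fun k => learning_objective P L (y k) (p k) (theta k)) @ U -->
    learning_objective P L ys ps thetas.
  apply: cvgD; last by apply: cvgMl_tmp; exact: (inner_product_cvg dotP).
  apply: (cvg_big (op := +%R)) => [|i _]; first exact: add_continuous.
  apply: cvgMl_tmp; have [yys pps] := ypsP i.
  have cyi k : {within `[0, horizon P], continuous (y k i)} by case: (cont k i).
  have cpi k : {within `[0, horizon P], continuous (p k i)} by case: (cont k i).
  exact: (@learning_cost_cvg _ _ _ _ P (@Vapp _ _ A eps) _ hP regP CW _ U _ theta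
    thetas (fun k => y k i) (fun k => p k i) (ys i) (ps i) (gamma1 L) (gamma2 L)
    thetaP cyi cpi yys pps).
move=> z q eta hz; rewrite (norm_cvg_unique objs objU).
apply: ge_inf; last by exists z, q, eta.
by exists 0 => _ [z' [q' [eta' [_ ->]]]].
Qed.
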